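(* Let $\mu>0$ and $$0<r\le\sqrt{\frac{(3+5\mu)-\sqrt{17\mu^{2}+26\mu+9}}{2}}$$ be real numbers. Then the function $$\mathbb{F}_{\mu}(r;z)=z+\sum_{n=2}^{\infty}\frac{n(r^2+1)^{\mu+1}}{(n^2+r^2)^{\mu+1}}z^n,\qquad z\in\mathbb{U},$$ is starlike in $\mathbb{U}$.
   Context: $\mathbb{U}=\{z\in\mathbb{C}:|z|<1\}$ is the open unit disk, and $\mathscr{A}$ is the class of analytic functions $f$ on $\mathbb{U}$ with $f(0)=0$ and $f'(0)=1$. A function $f\in\mathscr{A}$ is called starlike if it maps $\mathbb{U}$ onto a domain that is starlike with respect to the origin; analytically, starlike functions are characterized by $\Re\left(zf'(z)/f(z)\right)>0$ for all $z\in\mathbb{U}$ (the quotient being understood as its limit $1$ at $z=0$). *)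

(* Defs.v *)
From Stdlib Require Import Reals Lra Lia.
From Coquelicot Require Import Coquelicot.

Open Scope R_scope.

Definition unit_disk (z : C) : Prop := Cmod z < 1.

Definition image (f : C -> C) (D : C -> Prop) (w : C) : Prop :=
  exists z : C, D z /\ f z = w.

Definition connected_set (D : C -> Prop) : Prop :=
  forall A B : C -> Prop,
    open A -> open B ->
    (forall z, D z -> A z \/ B z) ->
    (forall z, D z -> A z -> B z -> False) ->
    (exists z, D z /\ A z) -> (exists z, D z /\ B z) -> False.

Definition domain (D : C -> Prop) : Prop :=
  (exists z, D z) /\ open D /\ connected_set D.

(* Every segment from the origin to a point of [D] lies in [D]; taking t = 0,
   a non-empty such [D] contains the origin. *)
Definition starlike_domain (D : C -> Prop) : Prop :=
  domain D /\
  forall (w : C) (t : R), D w -> 0 <= t <= 1 -> D (RtoC t * w)%C.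

(* Analyticity on the open disk is complex differentiability at each of its
   points. *)
Definition classA (f : C -> C) : Prop :=
  (forall z : C, unit_disk z -> @ex_derive C_AbsRing C_NormedModule f z) /\
  f (RtoC 0) = RtoC 0 /\
  @is_derive C_AbsRing C_NormedModule f (RtoC 0) (RtoC 1).

Definition univalent (f : C -> C) : Prop :=
  forall z1 z2 : C, unit_disk z1 -> unit_disk z2 -> f z1 = f z2 -> z1 = z2.

(* Univalence is part of the standard meaning of "f maps the disk onto a
   starlike domain": without it, Re (z f'(z) / f(z)) > 0 would not be equivalent
   to starlikeness, since a non-injective function of class A can also have a
   starlike image. *)
Definition starlike (f : C -> C) : Prop :=
  classA f /\ univalent f /\ starlike_domain (image f unit_disk).

(* The sum of a convergent complex series, an unspecified value otherwise. *)
Definition CSeries (a : nat -> C) : C :=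
  iota (fun l : C_CompleteNormedModule => @is_series C_AbsRing C_NormedModule a l).

Definition Fcoef (mu r : R) (n : nat) : R :=
  INR n * Rpower (r ^ 2 + 1) (mu + 1) / Rpower (INR n ^ 2 + r ^ 2) (mu + 1).

(* The sum over n >= 2, reindexed by n = k + 2. *)
Definition F (mu r : R) (z : C) : C :=
  (z + CSeries (fun k => RtoC (Fcoef mu r (k + 2)) * z ^ (k + 2)))%C.

Lemma CSeries_correct (a : nat -> C) :
  @ex_series C_AbsRing C_NormedModule a ->
  @is_series C_AbsRing C_NormedModule a (CSeries a).
Proof.
  intros [l Hl]. unfold CSeries.
  apply (@iota_correct C_AbsRing C_CompleteNormedModule (fun l => is_series a l)).
  exists l; split; [exact Hl|].
  intros y Hy.
  exact (@filterlim_locally_unique _ C_AbsRing C_NormedModule eventually _ _ l y Hl Hy).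
Qed.

Lemma Fcoef_bound (mu r : R) (n : nat) :
  0 < mu -> (1 <= n)%nat -> 0 <= Fcoef mu r n <= INR n.
Proof.
  intros Hmu Hn. unfold Fcoef.
  assert (H1 : 1 <= INR n) by (apply (le_INR 1); exact Hn).
  assert (Hr : 0 <= r ^ 2) by apply pow2_ge_0.
  assert (Hle : Rpower (r ^ 2 + 1) (mu + 1) <= Rpower (INR n ^ 2 + r ^ 2) (mu + 1)).
  { apply Rle_Rpower_l; nra. }
  assert (Hp : 0 < Rpower (r ^ 2 + 1) (mu + 1)) by apply exp_pos.
  assert (Hq : 0 < Rpower (INR n ^ 2 + r ^ 2) (mu + 1)) by apply exp_pos.
  split.
  - apply Rmult_le_pos; [nra|]. left; now apply Rinv_0_lt_compat.
  - apply Rle_div_l; [exact Hq|]. nra.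
Qed.

Lemma ex_series_F (mu r : R) (z : C) :
  0 < mu -> unit_disk z ->
  @ex_series C_AbsRing C_NormedModule
    (fun k => RtoC (Fcoef mu r (k + 2)) * z ^ (k + 2))%C.
Proof.
  intros Hmu Hz. unfold unit_disk in Hz.
  set (q := (Cmod z + 1) / 2).
  assert (Hz0 : 0 <= Cmod z) by apply Cmod_ge_0.
  assert (Hq : 0 < q < 1) by (unfold q; lra).
  assert (Hzq : Cmod z <= q) by (unfold q; lra).
  apply (@ex_series_le C_AbsRing C_CompleteNormedModule _
           (fun k => Rabs (INR (k + 2) * q ^ (k + 2)))).
  - intros n. change (Cmod (RtoC (Fcoef mu r (n + 2)) * z ^ (n + 2))%C
                      <= Rabs (INR (n + 2) * q ^ (n + 2))).
    rewrite Cmod_mult, Cmod_R, Cmod_pow, Rabs_mult.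
    destruct (Fcoef_bound mu r (n + 2) Hmu ltac:(lia)) as [H0 H1].
    apply Rmult_le_compat.
    + apply Rabs_pos.
    + now apply pow_le.
    + rewrite !Rabs_pos_eq; lra.
    + rewrite (Rabs_pos_eq (q ^ _)) by (apply pow_le; lra). apply pow_incr; lra.
  - apply ex_series_DAlembert with (k := q); [lra| |].
    + intros n. apply Rmult_integral_contrapositive; split.
      * apply not_0_INR; lia.
      * apply pow_nonzero; lra.
    + apply is_lim_seq_ext with (fun n => q + q * / (INR n + 2)).
      * intros n. rewrite Nat.add_succ_l. simpl pow. rewrite S_INR, plus_INR.
        simpl (INR 2).
        assert (0 <= INR n) by apply pos_INR.
        assert (q ^ (n + 2) <> 0) by (apply pow_nonzero; lra).
        replace ((INR n + (1 + 1) + 1) * (q * q ^ (n + 2)) /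
                 ((INR n + (1 + 1)) * q ^ (n + 2)))
          with (q + q * / (INR n + 2)) by (field; split; lra).
        rewrite Rabs_pos_eq; [reflexivity|].
        assert (0 < / (INR n + 2)) by (apply Rinv_0_lt_compat; lra). nra.
      * replace (Finite q) with (Finite (q + q * 0)) by (f_equal; ring).
        apply is_lim_seq_plus'; [apply is_lim_seq_const|].
        apply (is_lim_seq_scal_l _ q 0).
        apply is_lim_seq_ext with (fun n => / INR (n + 2)).
        { intros n. rewrite plus_INR. reflexivity. }
        apply (is_lim_seq_incr_n (fun n => / INR n) 2).
        apply (is_lim_seq_inv INR p_infty); [apply is_lim_seq_INR|discriminate].
Qed.

(* Main.v *)
Require Import Defs.
From Stdlib Require Import Reals Lra Lia Classical.
From Coquelicot Require Import Coquelicot.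

Open Scope R_scope.

(* Write b_n for (n+1) times the coefficient of z^(n+1); this is a constant times
   h(n+1) with h(x) = x^2 (x^2 + r^2)^(-mu-1), and the bound on r makes h
   convex and decreasing on [1, oo).
   For such b, summation by parts against the Fejer and conjugate Fejer kernels
   shows that f'(z) = sum b_n z^n satisfies Re f' >= 1/2 and that Im f' has the
   sign of Im z. Hence f' takes all its values on a radius in one closed quadrant,
   so Re (conj (f'(z)) f'(tz)) >= 1/4, and integrating over t gives
   Re (conj (z f'(z)) f(z)) >= |z|^2 / 4. Thus moving f(z) slightly towards 0
   moves the preimage z towards 0, with uniform constants on |z| <= q < 1;
   iterating shows that the image is star-shaped. Univalence follows from
   Re f' > 0. *)

(** [starlike] is the geometric notion, so an inequality for Re (z f' / f) would still have to be
    turned into a star-shaped image, usually by following the inverse of f along a radius. A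
    discrete step replaces that flow; its linearization errors must be uniform on |z| <= q and of
    order |z|^2 near the origin, where the gain |z|^2 / 4 degenerates too. All analysis of f passes
    through one second-order estimate, [smooth_with], which holds term by term for the power series
    and yields the derivative, local inverses and mean values. Positivity of Re f' alone would give
    univalence but not starlikeness; the sign of Im f' is what keeps f'(z) and f'(tz) within a right
    angle. The largest r allowed by the bound is the one for which h'' vanishes at x = 1. *)

(** * Complex series and powers *)

(* [sum_Sn] with the concrete addition in place of the abstract [plus]. *)
Lemma rsum_S (a : nat -> R) (n : nat) : sum_n a (S n) = sum_n a n + a (S n).
Proof. exact (sum_Sn a n). Qed.

Definition csum (a : nat -> C) (n : nat) : C := @sum_n C_NormedModule a n.

Lemma csum_O (a : nat -> C) : csum a 0 = a 0%nat.
Proof. exact (@sum_O C_NormedModule a). Qed.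

Lemma csum_S (a : nat -> C) (n : nat) :
  csum a (S n) = (csum a n + a (S n))%C.
Proof. exact (@sum_Sn C_NormedModule a n). Qed.

Lemma is_series_C_eps (a : nat -> C) (l : C) (eps : R) :
  @is_series C_AbsRing C_NormedModule a l -> 0 < eps ->
  exists N : nat, forall n : nat, (N <= n)%nat ->
    Cmod (csum a n - l)%C < eps.
Proof.
  intros H He.
  destruct (proj1 (@filterlim_locally_ball_norm C_AbsRing nat C_NormedModule
    eventually _ (csum a) l) H (mkposreal eps He)) as [N HN].
  exists N. exact HN.
Qed.

Lemma is_series_C_lin (a : nat -> C) (l : C) (p : C -> R) :
  (forall u v : C, p (u + v)%C = p u + p v) ->
  (forall u : C, Rabs (p u) <= Cmod u) ->
  @is_series C_AbsRing C_NormedModule a l ->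
  is_series (fun n => p (a n)) (p l).
Proof.
  intros Hadd Hb H.
  assert (Hs : forall n, sum_n (fun k => p (a k)) n = p (csum a n)).
  { induction n as [|n IH].
    - now rewrite sum_O, csum_O.
    - rewrite rsum_S, IH, csum_S, Hadd. reflexivity. }
  change (is_lim_seq (sum_n (fun n => p (a n))) (p l)).
  apply is_lim_seq_spec. intros eps.
  destruct (is_series_C_eps a l eps H (cond_pos eps)) as [N HN].
  exists N. intros n Hn. rewrite Hs.
  apply Rle_lt_trans with (2 := HN n Hn).
  apply Rle_trans with (2 := Hb _). right. f_equal.
  assert (E := Hadd (csum a n - l)%C l).
  replace (csum a n - l + l)%C
    with (csum a n) in E by ring.
  lra.
Qed.

Lemma Im_le_Cmod (z : C) : Rabs (Im z) <= Cmod z.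
Proof.
  eapply Rle_trans; [apply Rmax_r|apply Rmax_Cmod].
Qed.

Lemma is_series_Re (a : nat -> C) (l : C) :
  @is_series C_AbsRing C_NormedModule a l -> is_series (fun n => Re (a n)) (Re l).
Proof.
  apply is_series_C_lin; [reflexivity|apply re_le_Cmod].
Qed.

Lemma is_series_Im (a : nat -> C) (l : C) :
  @is_series C_AbsRing C_NormedModule a l -> is_series (fun n => Im (a n)) (Im l).
Proof.
  apply is_series_C_lin; [reflexivity|apply Im_le_Cmod].
Qed.

Lemma Cmod_series_le (a : nat -> C) (l : C) (c : nat -> R) (L : R) :
  @is_series C_AbsRing C_NormedModule a l ->
  (forall n, Cmod (a n) <= c n) -> (forall N, sum_n c N <= L) -> Cmod l <= L.
Proof.
  intros H Hc HL. apply le_epsilon. intros eps He.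
  destruct (is_series_C_eps a l eps H He) as [N HN].
  specialize (HN N (le_n N)).
  assert (Hs : Cmod (csum a N) <= sum_n c N).
  { clear HN. induction N as [|N IH].
    - rewrite sum_O, csum_O. apply Hc.
    - rewrite csum_S, rsum_S.
      eapply Rle_trans; [apply Cmod_triangle|].
      apply Rplus_le_compat; [exact IH|apply Hc]. }
  specialize (HL N).
  assert (Ht := Cmod_triangle (csum a N) (- (csum a N - l))%C).
  rewrite Cmod_opp in Ht.
  replace (csum a N + - (csum a N - l))%C with l in Ht by ring.
  lra.
Qed.

Lemma sum_pow_le (q : R) (N : nat) :
  0 <= q < 1 -> sum_n (fun n => q ^ n) N <= / (1 - q).
Proof.
  intros Hq. apply Rmult_le_reg_r with (1 - q); [lra|].
  rewrite Rinv_l by lra.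
  assert (E : sum_n (fun n => q ^ n) N * (1 - q) = 1 - q ^ S N).
  { induction N as [|N IH].
    - rewrite sum_O. simpl. ring.
    - rewrite rsum_S, Rmult_plus_distr_r, IH. simpl. ring. }
  rewrite E. assert (0 <= q ^ S N) by (apply pow_le; lra). lra.
Qed.

Lemma sum_n_pow_pred_le (q : R) (N : nat) :
  0 <= q < 1 -> sum_n (fun n => INR n * q ^ pred n) N <= / (1 - q) ^ 2.
Proof.
  intros Hq. assert (0 < (1 - q) ^ 2) by (apply pow_lt; lra).
  apply Rmult_le_reg_r with ((1 - q) ^ 2); [assumption|].
  rewrite Rinv_l by lra.
  assert (E : sum_n (fun n => INR n * q ^ pred n) N * (1 - q) ^ 2
              = 1 - (INR N + 1) * q ^ N + INR N * q ^ S N).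
  { induction N as [|N IH].
    - rewrite sum_O. simpl. ring.
    - rewrite rsum_S.
      rewrite Rmult_plus_distr_r, IH, S_INR. simpl. ring. }
  rewrite E. simpl pow.
  assert (0 <= q ^ N) by (apply pow_le; lra).
  assert (0 <= INR N) by apply pos_INR.
  assert (0 <= q ^ N * (1 + INR N * (1 - q))).
  { apply Rmult_le_pos; [assumption|]. nra. }
  lra.
Qed.

Lemma Cpow_diff_le (u v : C) (q : R) (n : nat) :
  Cmod u <= q -> Cmod v <= q ->
  Cmod (u ^ n - v ^ n)%C <= INR n * q ^ pred n * Cmod (u - v)%C.
Proof.
  intros Hu Hv. assert (Hq : 0 <= q) by (pose proof (Cmod_ge_0 u); lra).
  induction n as [|n IH].
  - simpl. replace (1 - 1)%C with (RtoC 0) by ring. rewrite Cmod_0. lra.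
  - replace (u ^ S n - v ^ S n)%C with (u * (u ^ n - v ^ n) + (u - v) * v ^ n)%C
      by (simpl; ring).
    eapply Rle_trans; [apply Cmod_triangle|]. rewrite !Cmod_mult, Cmod_pow.
    assert (H1 : Cmod v ^ n <= q ^ n) by (apply pow_incr; split; [apply Cmod_ge_0|lra]).
    pose proof (Cmod_ge_0 (u - v)).
    assert (E : q * (INR n * q ^ pred n) = INR n * q ^ n) by (destruct n; simpl; ring).
    rewrite S_INR. simpl pred.
    apply Rle_trans with (q * (INR n * q ^ pred n * Cmod (u - v)) + Cmod (u - v) * q ^ n).
    + apply Rplus_le_compat.
      * apply Rmult_le_compat; auto using Cmod_ge_0.
      * now apply Rmult_le_compat_l.
    + rewrite <- Rmult_assoc, E. right; ring.
Qed.

(** The slope is taken at a third point p, because the Newton iteration around p keeps the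
    derivative at p for all pairs u, v. The factor n + 1 is the one that the coefficient b_n / (n +
    1) of f cancels. *)
Lemma Cpow_linearization (p u v : C) (q d : R) (n : nat) :
  Cmod p <= q -> Cmod u <= q -> Cmod v <= q ->
  Cmod (u - p)%C <= d -> Cmod (v - p)%C <= d ->
  Cmod (u ^ S n - v ^ S n - RtoC (INR (S n)) * p ^ n * (u - v))%C
  <= INR (S n) * (INR n * q ^ pred n) * (d * Cmod (u - v)%C).
Proof.
  intros Hp Hu Hv Hup Hvp. assert (Hq : 0 <= q) by (pose proof (Cmod_ge_0 u); lra).
  induction n as [|n IH].
  - replace (u ^ 1 - v ^ 1 - RtoC (INR 1) * p ^ 0 * (u - v))%C with (RtoC 0)
      by (simpl; ring).
    rewrite Cmod_0. simpl. lra.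
  - replace (u ^ S (S n) - v ^ S (S n) - RtoC (INR (S (S n))) * p ^ S n * (u - v))%C
      with (u * (u ^ S n - v ^ S n - RtoC (INR (S n)) * p ^ n * (u - v))
            + (RtoC (INR (S n)) * p ^ n * (u - p) * (u - v)
               + (u - v) * (v ^ S n - p ^ S n)))%C
      by (rewrite (S_INR (S n)), RtoC_plus; simpl Cpow; ring).
    eapply Rle_trans; [apply Cmod_triangle|].
    eapply Rle_trans; [apply Rplus_le_compat_l, Cmod_triangle|].
    rewrite !Cmod_mult, Cmod_R, Cmod_pow, Rabs_pos_eq by apply pos_INR.
    assert (H1 : Cmod p ^ n <= q ^ n) by (apply pow_incr; split; [apply Cmod_ge_0|lra]).
    assert (H2 := Cpow_diff_le v p q (S n) Hv Hp). simpl pred in H2.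
    set (e := Cmod (u - v)) in *.
    assert (0 <= e) by apply Cmod_ge_0.
    assert (0 <= d) by (pose proof (Cmod_ge_0 (u - p)); lra).
    assert (0 <= INR n) by apply pos_INR.
    assert (0 <= INR (S n)) by apply pos_INR.
    assert (0 <= q ^ n) by now apply pow_le.
    assert (E : q * (INR n * q ^ pred n) = INR n * q ^ n) by (destruct n; simpl; ring).
    apply Rle_trans with (q * (INR (S n) * (INR n * q ^ pred n) * (d * e))
      + (INR (S n) * q ^ n * d * e + e * (INR (S n) * q ^ n * d))).
    + apply Rplus_le_compat; [|apply Rplus_le_compat].
      * apply Rmult_le_compat; auto using Cmod_ge_0.
      * apply Rmult_le_compat_r; [assumption|].
        apply Rmult_le_compat; auto using Cmod_ge_0.
        -- apply Rmult_le_pos; [assumption|apply pow_le, Cmod_ge_0].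
        -- now apply Rmult_le_compat_l.
      * apply Rmult_le_compat_l; [assumption|].
        eapply Rle_trans; [exact H2|]. apply Rmult_le_compat_l; [|assumption].
        now apply Rmult_le_pos.
    + replace (q * (INR (S n) * (INR n * q ^ pred n) * (d * e)))
        with (INR (S n) * (q * (INR n * q ^ pred n)) * (d * e)) by ring.
      rewrite E, (S_INR (S n)), !S_INR. simpl pred. right; ring.
Qed.

(** * Convex coefficient sequences *)

(* Rewriting with [sum_O] leaves an equality typed in a canonical structure,
   which [ring] does not recognise. *)
Local Ltac real_eq := match goal with |- ?a = ?b => change (@eq R a b) end.

Definition convex_decreasing (g : nat -> R) : Prop :=
  (forall n, 0 <= g n) /\ (forall n, g (S n) <= g n) /\
  (forall n, g (S n) - g (S (S n)) <= g n - g (S n)).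

(* Two summations by parts: the second differences of [g] weigh the double
   partial sums of [e]. *)
Lemma convex_sum_ge (g e : nat -> R) (N : nat) :
  convex_decreasing g -> (forall n, 0 <= sum_n (sum_n e) n) ->
  g N * sum_n e N <= sum_n (fun n => g n * e n) N.
Proof.
  intros [Hp [Hd Hc]] He.
  (* The difference [sum_n (sum_n e) N - sum_n e N] is the double sum up to N - 1. Its weight is the
     last slope of g, which convexity allows to be replaced by the next, smaller one. *)
  assert (H : (g N - g (S N)) * (sum_n (sum_n e) N - sum_n e N)
              <= sum_n (fun n => g n * e n) N - g N * sum_n e N
              /\ 0 <= sum_n (sum_n e) N - sum_n e N).
  { induction N as [|N [IH IH']].
    - rewrite !sum_O. split; [right; ring|lra].
    - rewrite !rsum_S. simpl.
      specialize (He N). specialize (Hc N). specialize (Hd N).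
      split; [|lra]. nra. }
  specialize (Hd N). nra.
Qed.

(** Consecutive terms differ by q^n ((g_n - g_{n+1}) + (1 - q) g_{n+1}), a product of nonincreasing
    nonnegative factors. This moves the study of the series from |z| = q to the unit circle. *)
Lemma convex_decreasing_geom (g : nat -> R) (q : R) :
  convex_decreasing g -> 0 <= q <= 1 -> convex_decreasing (fun n => g n * q ^ n).
Proof.
  intros [Hp [Hd Hc]] Hq.
  assert (Hqn : forall n, 0 <= q ^ n) by (intros; apply pow_le; lra).
  repeat split; intros n; simpl; specialize (Hqn n);
    pose proof (Hp n); pose proof (Hp (S n)); pose proof (Hp (S (S n)));
    pose proof (Hd n); pose proof (Hd (S n)); pose proof (Hc n).
  - nra.
  - replace (g (S n) * (q * q ^ n)) with ((g (S n) * q) * q ^ n) by ring.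
    apply Rmult_le_compat_r; [assumption|]. nra.
  - assert (0 <= (g n - g (S n)) + (1 - q) * g (S n)
            - q * ((g (S n) - g (S (S n))) + (1 - q) * g (S (S n)))).
    { assert (0 <= (1 - q) * (g (S n) - q * g (S (S n)))) by (apply Rmult_le_pos; nra).
      nra. }
    assert (0 <= q ^ n * ((g n - g (S n)) + (1 - q) * g (S n)
            - q * ((g (S n) - g (S (S n))) + (1 - q) * g (S (S n)))))
      by now apply Rmult_le_pos.
    nra.
Qed.

Lemma Re_pow_S (w : C) (n : nat) :
  Re (w ^ S n) = Re w * Re (w ^ n) - Im w * Im (w ^ n).
Proof. reflexivity. Qed.

Lemma Im_pow_S (w : C) (n : nat) :
  Im (w ^ S n) = Re w * Im (w ^ n) + Im w * Re (w ^ n).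
Proof. reflexivity. Qed.

(** The positivity of the conjugate kernel rests on this: for w = e^(it) it reads |sin(nt)| <= n
    |sin t|, and follows from the addition formula. *)
Lemma Rabs_Im_pow_le (w : C) (n : nat) :
  Cmod w = 1 -> Rabs (Im (w ^ n)) <= INR n * Rabs (Im w).
Proof.
  intros H. induction n as [|n IH].
  - simpl. rewrite Rabs_R0. lra.
  - rewrite Im_pow_S, S_INR. eapply Rle_trans; [apply Rabs_triang|].
    rewrite !Rabs_mult.
    assert (Rabs (Re w) <= 1) by (rewrite <- H; apply re_le_Cmod).
    assert (Rabs (Re (w ^ n)) <= 1).
    { replace 1 with (Cmod (w ^ n)) by (rewrite Cmod_pow, H; apply pow1).
      apply re_le_Cmod. }
    pose proof (Rabs_pos (Im (w ^ n))). pose proof (Rabs_pos (Im w)).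
    pose proof (Rabs_pos (Re w)). nra.
Qed.

(** Terms of the Dirichlet kernel 1 + 2 cos t + 2 cos 2t + ... at w = e^(it). *)
Definition cos_term (w : C) (n : nat) : R := (if n then 1 else 2) * Re (w ^ n).

(* With w = e^(it), the double partial sums are the Fejer kernels
   |1 + w + ... + w^n|^2. *)
Lemma fejer_kernel_nonneg (w : C) (n : nat) :
  Cmod w = 1 -> 0 <= sum_n (sum_n (cos_term w)) n.
Proof.
  intros H.
  set (A := sum_n (fun k => Re (w ^ k)) : nat -> R).
  set (B := sum_n (fun k => Im (w ^ k)) : nat -> R).
  assert (HA : forall k, sum_n (cos_term w) k = 2 * A k - 1).
  { induction k as [|k IH]; unfold A.
    - rewrite !sum_O. unfold cos_term. simpl. ring.
    - rewrite !rsum_S, IH. unfold cos_term, A; simpl. ring. }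
  assert (Hw : Re w ^ 2 + Im w ^ 2 = 1) by (rewrite <- Cmod2_alt, H; ring).
  assert (HA0 : A 0%nat = 1) by (unfold A; now rewrite sum_O).
  assert (HB0 : B 0%nat = 0) by (unfold B; now rewrite sum_O).
  assert (HAS : forall k, A (S k) = A k + Re (w ^ S k)) by (intros; apply rsum_S).
  assert (HBS : forall k, B (S k) = B k + Im (w ^ S k)) by (intros; apply rsum_S).
  (* The geometric sums s_k = A k + i B k satisfy s_{k+1} = 1 + w s_k. Hence, as |w| = 1,
     |s_{k+1}|^2 - |s_k|^2 = 2 A (S k) - 1, the partial sum in [HA]. *)
  assert (HAB : forall k, A (S k) = 1 + Re w * A k - Im w * B k
                      /\ B (S k) = Re w * B k + Im w * A k).
  { induction k as [|k [IH1 IH2]].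
    - rewrite HAS, HBS, HA0, HB0, Re_pow_S, Im_pow_S. simpl. split; ring.
    - rewrite (HAS (S k)), (HBS (S k)), (Re_pow_S w (S k)), (Im_pow_S w (S k)).
      replace (Re (w ^ S k)) with (A (S k) - A k) by (rewrite HAS; ring).
      replace (Im (w ^ S k)) with (B (S k) - B k) by (rewrite HBS; ring).
      split; lra. }
  assert (E : sum_n (sum_n (cos_term w)) n = A n ^ 2 + B n ^ 2).
  { induction n as [|n IH].
    - rewrite sum_O, HA, HA0, HB0. real_eq. ring.
    - rewrite rsum_S, IH, HA.
      destruct (HAB n) as [E1 E2]. rewrite E1, E2.
      real_eq.
      transitivity (A n ^ 2 * (Re w ^ 2 + Im w ^ 2) + B n ^ 2 * (Re w ^ 2 + Im w ^ 2)
        + (2 * (1 + Re w * A n - Im w * B n) - 1)); [rewrite Hw|]; ring. }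
  rewrite E. nra.
Qed.

(** The factor Im w = sin t makes the double sums nonnegative on the whole circle, the kernel itself
    being odd in t. *)
Definition sin_term (w : C) (n : nat) : R := Im w * Im (w ^ n).

(* The double partial sums of sin(kt) are
   ((n+1) sin t - sin((n+1)t)) / (2 - 2 cos t). *)
Lemma conjugate_fejer_kernel_nonneg (w : C) (n : nat) :
  Cmod w = 1 -> 0 <= sum_n (sum_n (sin_term w)) n.
Proof.
  intros H.
  assert (Hw : Re w ^ 2 + Im w ^ 2 = 1) by (rewrite <- Cmod2_alt, H; ring).
  assert (H1 : forall k, (2 - 2 * Re w) * sum_n (sin_term w) k
     = Im w * (Im w - Im (w ^ S k) + Im (w ^ k))).
  { induction k as [|k IH].
    - rewrite sum_O, Im_pow_S. unfold sin_term. simpl. ring.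
    - rewrite rsum_S.
      change ((2 - 2 * Re w) * (sum_n (sin_term w) k + sin_term w (S k)) =
         Im w * (Im w - Im (w ^ S (S k)) + Im (w ^ S k))).
      rewrite Rmult_plus_distr_l, IH. unfold sin_term.
      rewrite (Im_pow_S w (S k)), (Re_pow_S w k), (Im_pow_S w k).
      transitivity (Im w * (Im w + (Re w * Im (w ^ k) + Im w * Re (w ^ k))
        - 2 * Re w * (Re w * Im (w ^ k) + Im w * Re (w ^ k))
        + Im (w ^ k) * (Re w ^ 2 + Im w ^ 2))); [rewrite Hw|]; ring. }
  assert (H2 : (2 - 2 * Re w) * sum_n (sum_n (sin_term w)) n
     = Im w * (INR (S n) * Im w - Im (w ^ S n))).
  { induction n as [|n IH].
    - rewrite sum_O, H1. simpl. ring.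
    - rewrite rsum_S.
      change ((2 - 2 * Re w) * (sum_n (sum_n (sin_term w)) n + sum_n (sin_term w) (S n)) =
         Im w * (INR (S (S n)) * Im w - Im (w ^ S (S n)))).
      rewrite Rmult_plus_distr_l, IH, H1, (S_INR (S n)). ring. }
  (* At w = 1 the factor 2 - 2 Re w vanishes and the closed form says nothing, but for Im w = 0 all
     terms are 0. *)
  destruct (Req_dec (Im w) 0) as [E|E].
  - right. symmetry.
    assert (E1 : forall k, sum_n (sin_term w) k = 0).
    { induction k as [|k IH]; [rewrite sum_O|rewrite rsum_S, IH];
        unfold sin_term; simpl; rewrite E; ring. }
    clear H2. induction n as [|n IH]; [now rewrite sum_O|].
    rewrite rsum_S, IH, E1. simpl. ring.
  - assert (Hre : Re w < 1).
    { assert (0 < Im w ^ 2) by (apply pow2_gt_0; assumption). nra. }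
    apply Rmult_le_reg_l with (2 - 2 * Re w); [lra|].
    rewrite H2, Rmult_0_r.
    assert (H3 := Rabs_Im_pow_le w (S n) H).
    assert (Im w * Im (w ^ S n) <= INR (S n) * (Im w * Im w)).
    { apply Rle_trans with (1 := Rle_abs _). rewrite Rabs_mult.
      replace (Im w * Im w) with (Rabs (Im w) * Rabs (Im w)).
      - pose proof (Rabs_pos (Im w)). nra.
      - rewrite <- Rabs_mult. apply Rabs_pos_eq. nra. }
    lra.
Qed.

(** q^n is split as s^n s^n with s = sqrt q: n s^n stays bounded by the geometric sum, whose terms
    decrease, and the second s^n tends to 0. *)
Lemma is_lim_seq_lin_geom (q : R) :
  0 <= q < 1 -> is_lim_seq (fun n => (2 * INR n + 1) * q ^ n) 0.
Proof.
  intros Hq. set (s := sqrt q).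
  assert (Hs : 0 <= s < 1).
  { split; [apply sqrt_pos|]. unfold s. rewrite <- sqrt_1. apply sqrt_lt_1; lra. }
  assert (Hss : s * s = q) by (apply sqrt_sqrt; lra).
  assert (Hb : forall n, INR n * s ^ n <= / (1 - s)).
  { intros n. apply Rle_trans with (2 := sum_pow_le s n Hs).
    induction n as [|n IH].
    - rewrite sum_O. simpl. lra.
    - rewrite rsum_S, S_INR. simpl.
      assert (0 <= s ^ n) by (apply pow_le; lra).
      assert (0 <= INR n) by apply pos_INR.
      assert (INR n * (s * s ^ n) <= INR n * s ^ n) by (apply Rmult_le_compat_l; nra).
      lra. }
  apply is_lim_seq_le_le with (fun _ => 0) (fun n => (2 * / (1 - s) + 1) * s ^ n).
  - intros n. assert (0 <= INR n) by apply pos_INR.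
    assert (0 <= s ^ n) by (apply pow_le; lra).
    assert (s ^ n <= 1) by (rewrite <- (pow1 n); apply pow_incr; lra).
    rewrite <- Hss, Rpow_mult_distr. specialize (Hb n). split; nra.
  - apply is_lim_seq_const.
  - replace (Finite 0) with (Rbar_mult (2 * / (1 - s) + 1) 0) by (simpl; f_equal; ring).
    apply is_lim_seq_scal_l, is_lim_seq_geom. rewrite Rabs_pos_eq; lra.
Qed.

(** Partial sums are bounded below by the boundary term g_n q^n (e_0 + ... + e_n) of the summation
    by parts; it tends to 0 because the sum of the e_k grows at most linearly and q < 1. *)
Lemma convex_series_nonneg (g e : nat -> R) (q l : R) :
  convex_decreasing g -> g 0%nat <= 1 -> 0 <= q < 1 ->
  (forall n, Rabs (e n) <= 2) -> Rabs (e 0%nat) <= 1 ->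
  (forall n, 0 <= sum_n (sum_n e) n) ->
  is_series (fun n => g n * q ^ n * e n) l -> 0 <= l.
Proof.
  intros Hg Hg0 Hq He He0 Hs Hl.
  assert (Hg1 : forall n, 0 <= g n <= 1).
  { destruct Hg as [Hp [Hd _]]. intros n. split; [apply Hp|].
    induction n as [|n IH]; [assumption|]. specialize (Hd n). lra. }
  assert (Hb : forall n, - (2 * INR n + 1) <= sum_n e n <= 2 * INR n + 1).
  { induction n as [|n IH].
    - rewrite sum_O. simpl. apply Rabs_le_between. rewrite Rmult_0_r, Rplus_0_l. exact He0.
    - rewrite rsum_S, S_INR. simpl.
      specialize (He (S n)). apply Rabs_le_between in He. lra. }
  assert (L := is_lim_seq_le (fun n => - ((2 * INR n + 1) * q ^ n))
    (sum_n (fun n => g n * q ^ n * e n)) (Rbar_opp 0) l).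
  simpl in L. rewrite Ropp_0 in L. apply L.
  - intros n.
    eapply Rle_trans; [|apply (convex_sum_ge (fun n => g n * q ^ n) e n);
      [apply convex_decreasing_geom; [assumption|lra]|assumption]].
    simpl. specialize (Hb n). specialize (Hg1 n).
    assert (0 <= q ^ n) by (apply pow_le; lra).
    assert (0 <= 2 * INR n + 1) by (pose proof (pos_INR n); lra).
    assert (0 <= g n * q ^ n <= q ^ n) by nra.
    nra.
  - replace (Finite 0) with (Rbar_opp 0) by (simpl; f_equal; ring).
    apply -> is_lim_seq_opp. now apply is_lim_seq_lin_geom.
  - exact Hl.
Qed.

Lemma polar_form (z : C) :
  exists w : C, Cmod w = 1 /\ z = (RtoC (Cmod z) * w)%C.
Proof.
  destruct (Ceq_dec z 0) as [->|Hz].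
  - exists (RtoC 1). rewrite Cmod_0, Cmod_1. split; [reflexivity|ring].
  - assert (Hm : 0 < Cmod z) by now apply Cmod_gt_0.
    assert (RtoC (Cmod z) <> 0) by (intros E; apply RtoC_inj in E; lra).
    exists (z / RtoC (Cmod z))%C. split.
    + rewrite Cmod_div by assumption. rewrite Cmod_R, Rabs_pos_eq by lra. field. lra.
    + field. assumption.
Qed.

(** As b_0 = 1, the number 2 Re l - 1 is the sum of the b_n q^n times the Dirichlet terms. *)
Lemma convex_pow_series_Re (b : nat -> R) (z l : C) :
  convex_decreasing b -> b 0%nat = 1 -> Cmod z < 1 ->
  @is_series C_AbsRing C_NormedModule (fun n => RtoC (b n) * z ^ n)%C l ->
  1 / 2 <= Re l.
Proof.
  intros Hb Hb0 Hz Hl. destruct (polar_form z) as [w [Hw Ez]].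
  set (q := Cmod z) in *. assert (Hq : 0 <= q < 1) by (split; [apply Cmod_ge_0|assumption]).
  apply is_series_Re in Hl.
  apply (is_series_scal 2) in Hl.
  enough (0 <= 2 * Re l - 1) by lra.
  assert (Hre : forall n, Rabs (Re (w ^ n)) <= 1).
  { intros n. rewrite <- (pow1 n), <- Hw, <- Cmod_pow. apply re_le_Cmod. }
  apply (convex_series_nonneg b (cos_term w) q); try assumption; try lra.
  - intros n. unfold cos_term. rewrite Rabs_mult. specialize (Hre n).
    destruct n; rewrite (Rabs_pos_eq (_ : R)) by lra; lra.
  - unfold cos_term. rewrite Rmult_1_l. apply Hre.
  - intros n. now apply fejer_kernel_nonneg.
  - apply is_series_decr_1.
    apply (is_series_ext (fun n => 2 * Re (RtoC (b (S n)) * z ^ S n)%C)).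
    + intros n. rewrite re_scal_l, Ez, Cpow_mult_l, <- RtoC_pow, re_scal_l.
      unfold cos_term. real_eq. ring.
    + apply (is_series_incr_1 (fun n => 2 * Re (RtoC (b n) * z ^ n)%C)).
      match goal with |- is_series ?f ?x => replace x with (2 * Re l) end; [exact Hl|].
      unfold plus, opp, cos_term; simpl. rewrite Hb0. ring.
Qed.

(** Modulus and direction are separate arguments so that z and tz are tested against the same
    [Im w]; multiplying by it covers both half planes at once. *)
Lemma convex_pow_series_Im (b : nat -> R) (q : R) (w l : C) :
  convex_decreasing b -> b 0%nat = 1 -> 0 <= q < 1 -> Cmod w = 1 ->
  @is_series C_AbsRing C_NormedModule (fun n => RtoC (b n) * (RtoC q * w) ^ n)%C l ->
  0 <= Im w * Im l.
Proof.
  intros Hb Hb0 Hq Hw Hl.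
  apply is_series_Im in Hl.
  apply (is_series_scal (Im w)) in Hl.
  assert (Him : forall n, Rabs (Im (w ^ n)) <= 1).
  { intros n. rewrite <- (pow1 n), <- Hw, <- Cmod_pow. apply Im_le_Cmod. }
  assert (Hs : forall n, Rabs (sin_term w n) <= 1).
  { intros n. unfold sin_term. rewrite Rabs_mult. pose proof (Him n).
    pose proof (Im_le_Cmod w). pose proof (Rabs_pos (Im w)).
    pose proof (Rabs_pos (Im (w ^ n))). nra. }
  apply (convex_series_nonneg b (sin_term w) q); try assumption; try lra.
  - intros n. specialize (Hs n). lra.
  - apply Hs.
  - intros n. now apply conjugate_fejer_kernel_nonneg.
  - refine (is_series_ext _ _ _ _ Hl). intros n. cbv beta.
    rewrite Cpow_mult_l, <- RtoC_pow, !im_scal_l. unfold sin_term, scal; simpl.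
    unfold mult; simpl. ring.
Qed.

(** Covers the real axis, where [Im w] is 0 and the previous lemma gives no information. *)
Lemma pow_series_Im_real (b : nat -> R) (x : R) (l : C) :
  @is_series C_AbsRing C_NormedModule (fun n => RtoC (b n) * (RtoC x) ^ n)%C l ->
  Im l = 0.
Proof.
  intros Hl. apply is_series_Im in Hl.
  apply is_series_unique in Hl. rewrite <- Hl.
  apply is_series_unique.
  apply is_series_ext with (fun _ => 0).
  - intros n. rewrite <- RtoC_pow. simpl. ring.
  - change (is_lim_seq (sum_n (fun _ : nat => 0)) 0).
    apply is_lim_seq_ext with (fun _ => 0); [|apply is_lim_seq_const].
    intros n. rewrite sum_n_const. ring.
Qed.

(* The values on a radius lie in a common quadrant. *)
Lemma convex_pow_series_ray (b : nat -> R) (z l m : C) (t : R) :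
  convex_decreasing b -> b 0%nat = 1 -> Cmod z < 1 -> 0 <= t <= 1 ->
  @is_series C_AbsRing C_NormedModule (fun n => RtoC (b n) * z ^ n)%C l ->
  @is_series C_AbsRing C_NormedModule (fun n => RtoC (b n) * (RtoC t * z) ^ n)%C m ->
  1 / 4 <= Re (Cconj l * m)%C.
Proof.
  intros Hb Hb0 Hz Ht Hl Hm.
  assert (Htz : Cmod (RtoC t * z) < 1).
  { rewrite Cmod_mult, Cmod_R, Rabs_pos_eq by lra. pose proof (Cmod_ge_0 z). nra. }
  assert (H1 := convex_pow_series_Re b z l Hb Hb0 Hz Hl).
  assert (H2 := convex_pow_series_Re b _ m Hb Hb0 Htz Hm).
  assert (H3 : 0 <= Im l * Im m).
  { destruct (polar_form z) as [w [Hw Ez]].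
    set (q := Cmod z) in *. assert (Hq : 0 <= q < 1) by (split; [apply Cmod_ge_0|assumption]).
    destruct (Req_dec (Im w) 0) as [E|E].
    - assert (Ew : w = RtoC (Re w)).
      { destruct w as [x y]. simpl in E. rewrite E. reflexivity. }
      rewrite Ez, Ew, <- RtoC_mult in Hl. apply pow_series_Im_real in Hl. rewrite Hl. lra.
    - rewrite Ez in Hl.
      assert (Hm' : @is_series C_AbsRing C_NormedModule
        (fun n => RtoC (b n) * (RtoC (t * q) * w) ^ n)%C m).
      { rewrite RtoC_mult, <- Cmult_assoc, <- Ez. exact Hm. }
      apply convex_pow_series_Im in Hl; try assumption.
      apply convex_pow_series_Im in Hm'; try assumption; [|nra].
      assert (0 <= (Im w * Im l) * (Im w * Im m)) by now apply Rmult_le_pos.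
      assert (0 < Im w * Im w) by nra.
      apply Rmult_le_reg_l with (Im w * Im w); [assumption|].
      rewrite Rmult_0_r.
      replace (Im w * Im w * (Im l * Im m)) with ((Im w * Im l) * (Im w * Im m)) by ring.
      assumption. }
  (* Re (conj l * m) = Re l Re m + Im l Im m, where the first product is at least 1/2 * 1/2 and the
     second is nonnegative. *)
  rewrite re_mult. simpl. unfold Re, Im in *. nra.
Qed.

(** * Local inversion and mean values *)

Lemma Cmod_sub_triangle (x y z : C) : Cmod (x - z) <= Cmod (x - y) + Cmod (y - z).
Proof.
  replace (x - z)%C with ((x - y) + (y - z))%C by ring. apply Cmod_triangle.
Qed.

Lemma Cmod_sub_sym (x y : C) : Cmod (x - y) = Cmod (y - x).
Proof. replace (x - y)%C with (- (y - x))%C by ring. apply Cmod_opp. Qed.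

(** Iteration from p: the increments are at most (d / 2) 2^(-n), with sum at most d, so the closed
    disc is never left. The limit is taken as p plus the series of increments. *)
Lemma contraction_fixed_point (T : C -> C) (p : C) (d : R) :
  0 <= d ->
  (forall u v, Cmod (u - p) <= d -> Cmod (v - p) <= d ->
     Cmod (T u - T v) <= / 2 * Cmod (u - v)) ->
  Cmod (T p - p) <= d / 2 ->
  exists x, Cmod (x - p) <= d /\ T x = x.
Proof.
  intros Hd HT Hp.
  assert (Hball : forall u, Cmod (u - p) <= d -> Cmod (T u - p) <= d).
  { intros u Hu. eapply Rle_trans; [apply (Cmod_sub_triangle _ (T p))|].
    assert (Hpp : Cmod (p - p) <= d).
    { replace (p - p)%C with (RtoC 0) by ring. now rewrite Cmod_0. }
    specialize (HT u p Hu Hpp). lra. }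
  set (x := fix x n := match n with O => p | S k => T (x k) end).
  assert (Hx : forall n, Cmod (x n - p) <= d).
  { induction n as [|n IH]; simpl.
    - replace (p - p)%C with (RtoC 0) by ring. now rewrite Cmod_0.
    - now apply Hball. }
  assert (Hstep : forall n, Cmod (x (S n) - x n) <= d / 2 * (/ 2) ^ n).
  { induction n as [|n IH].
    - simpl. lra.
    - change (Cmod (T (x (S n)) - T (x n)) <= d / 2 * (/ 2) ^ S n).
      eapply Rle_trans; [apply HT; apply Hx|]. simpl pow. lra. }
  assert (Hex : exists l : C, @is_series C_AbsRing C_NormedModule (fun n => x (S n) - x n)%C l).
  { apply (@ex_series_le C_AbsRing C_CompleteNormedModule _ (fun n => d / 2 * (/ 2) ^ n)).
    - exact Hstep.
    - apply (@ex_series_scal R_AbsRing R_NormedModule (d / 2) (fun n => (/ 2) ^ n)), ex_series_geom.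
      rewrite Rabs_pos_eq; lra. }
  destruct Hex as [l Hl].
  assert (Hsum : forall n, csum (fun n => x (S n) - x n)%C n = (x (S n) - p)%C).
  { induction n as [|n IH].
    - now rewrite csum_O.
    - rewrite csum_S, IH. ring. }
  assert (Hlp : Cmod ((p + l) - p) <= d).
  { replace (p + l - p)%C with l by ring.
    apply (Cmod_series_le _ l _ d Hl Hstep).
    intros N. rewrite (sum_n_mult_l (K := R_Ring) (d / 2) (fun n => (/ 2) ^ n)).
    assert (H := sum_pow_le (/ 2) N ltac:(lra)).
    replace (/ (1 - / 2)) with 2 in H by field.
    apply Rmult_le_compat_l with (r := d / 2) in H; [|lra].
    apply Rle_trans with (1 := H). lra. }
  set (y := (p + l)%C) in *. exists y. split; [assumption|].
  enough (H : Cmod (T y - y) <= 0).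
  { assert (E : (T y - y)%C = RtoC 0).
    { apply Cmod_eq_0. pose proof (Cmod_ge_0 (T y - y)). lra. }
    replace (T y) with ((T y - y) + y)%C by ring.
    rewrite E. ring. }
  apply le_epsilon. intros eps Heps.
  destruct (is_series_C_eps _ l (eps / 2) Hl ltac:(lra)) as [N HN].
  assert (H1 := HN N (le_n N)). assert (H2 := HN (S N) ltac:(lia)).
  rewrite Hsum in H1, H2.
  replace (x (S N) - p - l)%C with (x (S N) - y)%C in H1 by (unfold y; ring).
  replace (x (S (S N)) - p - l)%C with (x (S (S N)) - y)%C in H2 by (unfold y; ring).
  assert (H3 := HT y (x (S N)) Hlp (Hx (S N))).
  rewrite (Cmod_sub_sym y) in H3.
  assert (H4 := Cmod_sub_triangle (T y) (x (S (S N))) y).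
  change (x (S (S N))) with (T (x (S N))) in H2, H4. lra.
Qed.

(** Newton's iteration u + (w - f u) / a with the slope frozen at a: it contracts by 1/2, and its
    first step from p has length at most d / 2. *)
Lemma local_surjectivity (f : C -> C) (a p w : C) (d : R) :
  a <> RtoC 0 ->
  (forall u v, Cmod (u - p) <= d -> Cmod (v - p) <= d ->
     Cmod (f u - f v - a * (u - v)) <= Cmod a / 2 * Cmod (u - v)) ->
  Cmod (w - f p) <= Cmod a * d / 2 ->
  exists u, Cmod (u - p) <= d /\ f u = w.
Proof.
  intros Ha Hf Hw. assert (Hma : 0 < Cmod a) by now apply Cmod_gt_0.
  assert (Hd : 0 <= d) by (pose proof (Cmod_ge_0 (w - f p)); nra).
  destruct (contraction_fixed_point (fun u => u + (w - f u) / a)%C p d Hd) as [u [Hu E]].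
  - intros u v Hu Hv.
    replace (u + (w - f u) / a - (v + (w - f v) / a))%C
      with (- ((f u - f v - a * (u - v)) / a))%C by (field; assumption).
    rewrite Cmod_opp, Cmod_div by assumption.
    apply Rle_div_l; [assumption|]. specialize (Hf u v Hu Hv). lra.
  - replace (p + (w - f p) / a - p)%C with ((w - f p) / a)%C by (field; assumption).
    rewrite Cmod_div by assumption. apply Rle_div_l; [assumption|]. lra.
  - exists u. split; [assumption|].
    assert (E' : (w - f u = a * ((u + (w - f u) / a) - u))%C) by (field; assumption).
    rewrite E in E'.
    replace (f u) with (w - (w - f u))%C by ring. rewrite E'. ring.
Qed.

(* [M] bounds [g = f'], and [M * d] its oscillation on discs of radius [d]. *)
Definition smooth_with (f g : C -> C) : Prop :=
  forall q, 0 <= q < 1 -> exists M, 1 <= M /\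
    (forall z, Cmod z <= q -> Cmod (g z) <= M) /\
    (forall p u v d, Cmod p <= q -> Cmod u <= q -> Cmod v <= q ->
       Cmod (u - p) <= d -> Cmod (v - p) <= d ->
       Cmod (f u - f v - g p * (u - v)) <= M * (d * Cmod (u - v))).

Lemma Cmod_segment_le (u v : C) (t q : R) :
  Cmod u <= q -> Cmod v <= q -> 0 <= t <= 1 -> Cmod (v + RtoC t * (u - v)) <= q.
Proof.
  intros Hu Hv Ht.
  replace (v + RtoC t * (u - v))%C with (RtoC (1 - t) * v + RtoC t * u)%C
    by (rewrite RtoC_minus; ring).
  eapply Rle_trans; [apply Cmod_triangle|].
  rewrite !Cmod_mult, !Cmod_R, !Rabs_pos_eq by lra. nra.
Qed.

(** Stands in for integrating f' along the segment: over N + 1 equal pieces of relative length s the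
    linearization errors add up to at most K s, which vanishes as N grows. *)
Lemma complex_mean_value_le (f g : C -> C) (u v k : C) (q c : R) :
  smooth_with f g -> 0 <= q < 1 -> Cmod u <= q -> Cmod v <= q ->
  (forall t, 0 <= t <= 1 -> c <= Re (k * (g (v + RtoC t * (u - v))%C * (u - v)))) ->
  c <= Re (k * (f u - f v)).
Proof.
  intros Hs Hq Hu Hv Hc. destruct (Hs q Hq) as [M [HM [_ HL]]].
  set (e := Cmod (u - v)).
  set (K := Cmod k * M * e * e).
  assert (Hk : 0 <= Cmod k) by apply Cmod_ge_0.
  assert (He : 0 <= e) by apply Cmod_ge_0.
  assert (HK : 0 <= K) by (unfold K; repeat apply Rmult_le_pos; lra).
  assert (HN : forall N, c - K * / INR (S N) <= Re (k * (f u - f v))).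
  { intros N. set (s := / INR (S N)).
    assert (HSN : 1 <= INR (S N)) by (rewrite S_INR; pose proof (pos_INR N); lra).
    assert (Hs0 : 0 < s) by (apply Rinv_0_lt_compat; lra).
    assert (HsN : INR (S N) * s = 1) by (apply Rinv_r; lra).
    set (pt := fun j => (v + RtoC (INR j * s) * (u - v))%C).
    assert (Hin : forall j, (j <= S N)%nat -> 0 <= INR j * s <= 1).
    { intros j Hj. split; [apply Rmult_le_pos; [apply pos_INR|lra]|].
      rewrite <- HsN. apply Rmult_le_compat_r; [lra|]. now apply le_INR. }
    assert (Hj : forall j, (j <= S N)%nat ->
      INR j * (c * s - K * (s * s)) <= Re (k * (f (pt j) - f v))).
    { induction j as [|j IH]; intros Hj.
      - unfold pt. simpl INR. rewrite !Rmult_0_l.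
        replace (v + RtoC 0 * (u - v))%C with v by ring.
        replace (k * (f v - f v))%C with (RtoC 0) by ring. simpl. lra.
      - specialize (IH ltac:(lia)).
        assert (Hd : (pt (S j) - pt j = RtoC s * (u - v))%C).
        { unfold pt. rewrite S_INR, Rmult_plus_distr_r, Rmult_1_l, RtoC_plus. ring. }
        assert (Hmd : Cmod (pt (S j) - pt j) = s * e).
        { rewrite Hd, Cmod_mult, Cmod_R, Rabs_pos_eq by lra. reflexivity. }
        assert (H1 := HL (pt j) (pt (S j)) (pt j) (s * e)).
        rewrite Hmd in H1.
        assert (H2 : Cmod (f (pt (S j)) - f (pt j) - g (pt j) * (pt (S j) - pt j))
                     <= M * (s * e * (s * e))).
        { apply H1.
          - apply Cmod_segment_le; auto. apply Hin. lia.
          - apply Cmod_segment_le; auto.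
          - apply Cmod_segment_le; auto. apply Hin. lia.
          - lra.
          - replace (pt j - pt j)%C with (RtoC 0) by ring. rewrite Cmod_0. nra. }
        clear H1. rewrite Hd in H2.
        specialize (Hc (INR j * s) (Hin j ltac:(lia))). fold (pt j) in Hc.
        set (r := (f (pt (S j)) - f (pt j) - g (pt j) * (RtoC s * (u - v)))%C) in *.
        replace (k * (f (pt (S j)) - f v))%C
          with (k * (f (pt j) - f v) + (RtoC s * (k * (g (pt j) * (u - v))) + k * r))%C
          by (unfold r; ring).
        assert (Hr : - (Cmod k * (M * (s * e * (s * e)))) <= Re (k * r)).
        { assert (A1 := re_le_Cmod (k * r)). rewrite Cmod_mult in A1.
          apply Rabs_le_between in A1.
          assert (Cmod k * Cmod r <= Cmod k * (M * (s * e * (s * e))))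
            by now apply Rmult_le_compat_l.
          lra. }
        assert (Hadd : forall x y, Re (x + y)%C = Re x + Re y) by reflexivity.
        rewrite !Hadd, re_scal_l, S_INR.
        replace (Cmod k * (M * (s * e * (s * e)))) with (K * (s * s)) in Hr
          by (unfold K; ring).
        assert (s * c <= s * Re (k * (g (pt j) * (u - v)))) by (apply Rmult_le_compat_l; lra).
        lra. }
    specialize (Hj (S N) (le_n _)). unfold pt in Hj. rewrite HsN in Hj.
    replace (v + RtoC 1 * (u - v))%C with u in Hj by ring.
    replace (INR (S N) * (c * s - K * (s * s))) with ((INR (S N) * s) * (c - K * s)) in Hj by ring.
    rewrite HsN, Rmult_1_l in Hj. exact Hj. }
  apply le_epsilon. intros eps Heps.
  destruct (Req_dec K 0) as [E|E].
  - specialize (HN 0%nat). rewrite E in HN. lra.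
  - destruct (archimed_cor1 (eps / K)) as [N [H1 H2]].
    { apply Rdiv_lt_0_compat; lra. }
    destruct N as [|N]; [lia|]. specialize (HN N).
    apply Rlt_div_r in H1; [|lra]. lra.
Qed.

(** * Starlikeness *)

Lemma open_C_ball (A : C -> Prop) (x : C) :
  open A -> A x -> exists eps, 0 < eps /\ forall y, Cmod (y - x) < eps -> A y.
Proof.
  intros HA Hx.
  destruct (@locally_norm_le_locally C_AbsRing C_NormedModule x A (HA x Hx)) as [eps He].
  exists eps. split; [apply cond_pos|exact He].
Qed.

Lemma open_C_intro (A : C -> Prop) :
  (forall x, A x -> exists eps, 0 < eps /\ forall y, Cmod (y - x) < eps -> A y) ->
  open A.
Proof.
  intros H x Hx. apply (@locally_le_locally_norm C_AbsRing C_NormedModule x A).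
  destruct (H x Hx) as [eps [He Hy]]. exists (mkposreal eps He). exact Hy.
Qed.

Lemma open_C_ray (A : C -> Prop) (b : C) (m : R) :
  open A -> A (RtoC m * b)%C ->
  exists d, 0 < d /\ forall s, Rabs (s - m) < d -> A (RtoC s * b)%C.
Proof.
  intros HA Hm. destruct (open_C_ball A _ HA Hm) as [eps [He H]].
  pose proof (Cmod_ge_0 b). exists (eps / (Cmod b + 1)). split.
  - apply Rdiv_lt_0_compat; lra.
  - intros s Hs. apply H.
    replace (RtoC s * b - RtoC m * b)%C with (RtoC (s - m) * b)%C
      by (rewrite RtoC_minus; ring).
    rewrite Cmod_mult, Cmod_R. apply Rlt_div_r in Hs; [|lra].
    pose proof (Rabs_pos (s - m)). nra.
Qed.

(** Let m be the supremum of the t whose whole initial segment lies in A. If the point at m is in A,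
    openness forces m = 1, where B holds; if it is in B, so are points just before it that belong to
    A. *)
Lemma segment_not_separated (A B D : C -> Prop) (b : C) :
  (forall t, 0 <= t <= 1 -> D (RtoC t * b)%C) ->
  open A -> open B ->
  (forall z, D z -> A z \/ B z) -> (forall z, D z -> A z -> B z -> False) ->
  A (RtoC 0 * b)%C -> B (RtoC 1 * b)%C -> False.
Proof.
  intros HD HA HB Hc Hd H0 H1.
  set (E := fun t => 0 <= t <= 1 /\ forall s, 0 <= s <= t -> A (RtoC s * b)%C).
  assert (HE0 : E 0).
  { split; [lra|]. intros s Hs. now replace s with 0 by lra. }
  destruct (completeness E) as [m [Hub Hlub]].
  { exists 1. intros t [Ht _]. lra. }
  { now exists 0. }
  assert (Hm : 0 <= m <= 1).
  { split; [now apply Hub|]. apply Hlub. intros t [Ht _]. lra. }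
  assert (Hnear : forall d, 0 < d -> exists t, E t /\ m - d < t <= m).
  { intros d Hd0. apply NNPP. intros Hn.
    assert (m <= m - d); [|lra]. apply Hlub. intros t Ht.
    destruct (Rle_dec t (m - d)) as [|Hlt]; [assumption|].
    exfalso. apply Hn. exists t. pose proof (Hub t Ht). split; [assumption|lra]. }
  destruct (Hc _ (HD m Hm)) as [HAm|HBm].
  - destruct (open_C_ray A b m HA HAm) as [d [Hd0 HdA]].
    destruct (Hnear d Hd0) as [t [[Ht Hs] Htm]].
    set (m' := Rmin 1 (m + d / 2)).
    assert (Hm' : m' <= 1 /\ m' <= m + d / 2) by (split; [apply Rmin_l|apply Rmin_r]).
    assert (HEm : E m').
    { split; [split; [unfold m'; apply Rmin_glb; lra|lra]|].
      intros s Hs'. destruct (Rle_dec s t) as [Hst|Hst]; [apply Hs; lra|].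
      apply HdA. apply Rabs_def1; lra. }
    assert (Hle := Hub m' HEm).
    assert (m = 1).
    { unfold m', Rmin in Hle. destruct (Rle_dec 1 (m + d / 2)); lra. }
    subst m. exact (Hd _ (HD 1 Hm) HAm H1).
  - destruct (open_C_ray B b m HB HBm) as [d [Hd0 HdB]].
    destruct (Hnear d Hd0) as [t [[Ht Hs] Htm]].
    apply (Hd _ (HD t Ht)); [apply Hs; lra|].
    apply HdB. apply Rabs_def1; lra.
Qed.

(** The origin lies in one of the two open sets; the segment from it to a point in the other is then
    separated. *)
Lemma star_shaped_connected (D : C -> Prop) :
  (forall (w : C) (t : R), D w -> 0 <= t <= 1 -> D (RtoC t * w)%C) ->
  connected_set D.
Proof.
  intros HD A B HA HB Hc Hd [a [Da Aa]] [b [Db Bb]].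
  assert (E0 : forall x y, (RtoC 0 * x = RtoC 0 * y)%C) by (intros; ring).
  assert (E1 : forall x, (RtoC 1 * x = x)%C) by (intros; ring).
  destruct (Hc _ (HD a 0 Da ltac:(lra))) as [A0|B0].
  - apply (segment_not_separated A B D b); auto.
    + now rewrite (E0 b a).
    + now rewrite E1.
  - apply (segment_not_separated B A D a); auto.
    + intros z Dz. destruct (Hc z Dz); auto.
    + intros z Dz Bz Az. now apply (Hd z).
    + now rewrite E1.
Qed.

Lemma Re_Cconj_mul_self (z w : C) : Re (Cconj z * (w * z))%C = Cmod z ^ 2 * Re w.
Proof. rewrite Cmod2_alt. destruct z, w. simpl. ring. Qed.

(** For a = f'(z) this converts Re (conj z * h), the first-order change of |z|^2 / 2 under the
    displacement h, into a statement on f'(z) h without division. *)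
Lemma Cmod2_mul_Re (a z h : C) :
  Cmod a ^ 2 * Re (Cconj z * h) = Re (Cconj (z * a) * (a * h)).
Proof. rewrite Cmod2_alt. destruct a, z, h. simpl. ring. Qed.

Lemma Cmod2_plus (z h : C) :
  Cmod (z + h) ^ 2 = Cmod z ^ 2 + 2 * Re (Cconj z * h) + Cmod h ^ 2.
Proof. rewrite !Cmod2_alt. destruct z, h. simpl. ring. Qed.

(** The Noshiro-Warschawski argument: tested against conj (z1 - z2), the derivative along the
    segment has real part |z1 - z2|^2 Re f', so equal values of f force z1 = z2. *)
Lemma univalent_of_Re_pos (f g : C -> C) :
  smooth_with f g -> (forall z, Cmod z < 1 -> 1 / 2 <= Re (g z)) -> univalent f.
Proof.
  intros Hs Hg z1 z2 H1 H2 E. unfold unit_disk in *.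
  set (q := Rmax (Cmod z1) (Cmod z2)).
  assert (Hq : 0 <= q < 1).
  { split; [|now apply Rmax_lub_lt].
    apply Rle_trans with (2 := Rmax_l _ _), Cmod_ge_0. }
  assert (H := complex_mean_value_le f g z1 z2 (Cconj (z1 - z2)) q
    (Cmod (z1 - z2) ^ 2 * (1 / 2)) Hs Hq (Rmax_l _ _) (Rmax_r _ _)).
  rewrite E in H.
  replace (Cconj (z1 - z2) * (f z2 - f z2))%C with (RtoC 0) in H by ring.
  assert (Hz : Cmod (z1 - z2) ^ 2 * (1 / 2) <= 0).
  { apply H. intros t Ht. rewrite Re_Cconj_mul_self.
    apply Rmult_le_compat_l; [apply pow2_ge_0|]. apply Hg.
    apply Rle_lt_trans with q; [|lra].
    apply Cmod_segment_le; [apply Rmax_l|apply Rmax_r|assumption]. }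
  assert (Hz0 : Cmod (z1 - z2) = 0) by (pose proof (Cmod_ge_0 (z1 - z2)); nra).
  apply Cmod_eq_0 in Hz0.
  replace z1 with ((z1 - z2) + z2)%C by ring. rewrite Hz0. ring.
Qed.

Lemma is_derive_smooth_with (f g : C -> C) (z : C) :
  smooth_with f g -> Cmod z < 1 ->
  @is_derive C_AbsRing C_NormedModule f z (g z).
Proof.
  intros Hs Hz. set (q := (1 + Cmod z) / 2).
  assert (Hq : 0 <= q < 1) by (unfold q; pose proof (Cmod_ge_0 z); lra).
  destruct (Hs q Hq) as [M [HM [_ HL]]].
  split.
  - apply (@is_linear_scal_l C_AbsRing C_NormedModule).
  - intros x Hx.
    assert (E : z = x) by exact (@is_filter_lim_locally_unique C_AbsRing
      (AbsRing_NormedModule C_AbsRing) z x Hx).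
    subst x. intros eps.
    assert (Hd : 0 < Rmin (eps / M) ((1 - Cmod z) / 2)).
    { apply Rmin_pos; [|lra]. apply Rdiv_lt_0_compat; [apply cond_pos|lra]. }
    exists (mkposreal _ Hd). intros y Hy.
    change (Cmod (y - z) < Rmin (eps / M) ((1 - Cmod z) / 2)) in Hy.
    change (Cmod (f y - f z - (y - z) * g z) <= eps * Cmod (y - z)).
    assert (Hy1 := Rlt_le_trans _ _ _ Hy (Rmin_l _ _)).
    assert (Hy2 := Rlt_le_trans _ _ _ Hy (Rmin_r _ _)).
    apply Rlt_div_r in Hy1; [|lra].
    rewrite (Cmult_comm (y - z)).
    eapply Rle_trans; [apply (HL z y z (Cmod (y - z)))|].
    + unfold q. lra.
    + replace y with ((y - z) + z)%C by ring.
      eapply Rle_trans; [apply Cmod_triangle|]. unfold q. lra.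
    + unfold q. lra.
    + lra.
    + replace (z - z)%C with (RtoC 0) by ring. rewrite Cmod_0. apply Cmod_ge_0.
    + rewrite <- Rmult_assoc. apply Rmult_le_compat_r; [apply Cmod_ge_0|]. lra.
Qed.

(** Open mapping with explicit radii. Since |g p| >= 1/2, the condition M d <= 1/4 makes the
    relative linearization error at most |g p| / 2, and d / 4 is within the reach |g p| d / 2 of
    [local_surjectivity]. The bound on |f z| is linear in |z| so that radial steps shrink with
    |z|. *)
Lemma smooth_with_image_ball (f g : C -> C) (q : R) :
  smooth_with f g -> f (RtoC 0) = RtoC 0 -> g (RtoC 0) = RtoC 1 ->
  (forall z, Cmod z < 1 -> 1 / 2 <= Re (g z)) -> 0 <= q < 1 ->
  exists M, 1 <= M /\
    (forall z, Cmod z <= q -> Cmod (g z) <= M /\ Cmod (f z) <= 2 * M * Cmod z) /\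
    (forall p d w, Cmod p <= q -> d <= (1 - q) / 2 -> M * d <= 1 / 4 ->
       Cmod (w - f p) <= d / 4 ->
       exists u, Cmod (u - p) <= d /\ f u = w /\
         Cmod (f u - f p - g p * (u - p)) <= M * (d * d)).
Proof.
  intros Hs Hf0 Hg0 Hg Hq. set (q' := (1 + q) / 2).
  assert (Hq' : 0 <= q' < 1) by (unfold q'; lra).
  assert (Hqq : q <= q') by (unfold q'; lra).
  destruct (Hs q' Hq') as [M [HM [HB HL]]].
  exists M. split; [assumption|]. split.
  - intros z Hz. split; [apply HB; lra|].
    assert (H := HL (RtoC 0) z (RtoC 0) (Cmod z)).
    rewrite Cmod_0, Hf0, Hg0 in H.
    replace (z - RtoC 0)%C with z in H by ring.
    replace (RtoC 0 - RtoC 0)%C with (RtoC 0) in H by ring.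
    replace (f z - RtoC 0 - RtoC 1 * z)%C with (f z - z)%C in H by ring.
    rewrite Cmod_0 in H. pose proof (Cmod_ge_0 z).
    specialize (H ltac:(lra) ltac:(lra) ltac:(lra) ltac:(lra) ltac:(lra)).
    replace (f z) with ((f z - z) + z)%C by ring.
    eapply Rle_trans; [apply Cmod_triangle|].
    assert (M * (Cmod z * Cmod z) <= M * Cmod z * 1).
    { replace (M * (Cmod z * Cmod z)) with (M * Cmod z * Cmod z) by ring.
      apply Rmult_le_compat_l; [apply Rmult_le_pos; lra|lra]. }
    assert (1 * Cmod z <= M * Cmod z) by (apply Rmult_le_compat_r; lra). lra.
  - intros p d w Hp Hd HMd Hw.
    assert (Hd0 : 0 <= d) by (pose proof (Cmod_ge_0 (w - f p)); lra).
    assert (Hball : forall u, Cmod (u - p) <= d -> Cmod u <= q').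
    { intros u Hu. replace u with ((u - p) + p)%C by ring.
      eapply Rle_trans; [apply Cmod_triangle|]. unfold q'. lra. }
    assert (Hgp : 1 / 2 <= Cmod (g p)).
    { assert (H1 := Hg p ltac:(lra)). assert (H2 := re_le_Cmod (g p)).
      apply Rabs_le_between in H2. lra. }
    destruct (local_surjectivity f (g p) p w d) as [u [Hu E]].
    + apply Cmod_gt_0. lra.
    + intros u v Hu Hv. eapply Rle_trans; [apply (HL p u v d); auto; lra|].
      rewrite <- Rmult_assoc. apply Rmult_le_compat_r; [apply Cmod_ge_0|]. lra.
    + nra.
    + exists u. split; [assumption|]. split; [assumption|].
      eapply Rle_trans; [apply (HL p u p d); auto; try lra|].
      * replace (p - p)%C with (RtoC 0) by ring. rewrite Cmod_0. lra.
      * apply Rmult_le_compat_l; [lra|]. now apply Rmult_le_compat_l.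
Qed.

Lemma ray_product_bound (f g : C -> C) (z : C) :
  smooth_with f g -> f (RtoC 0) = RtoC 0 -> Cmod z < 1 ->
  (forall t, 0 <= t <= 1 -> 1 / 4 <= Re (Cconj (g z) * g (RtoC t * z)%C)) ->
  Cmod z ^ 2 / 4 <= Re (Cconj (z * g z) * f z).
Proof.
  intros Hs Hf0 Hz H.
  replace (f z) with (f z - f (RtoC 0))%C by (rewrite Hf0; ring).
  apply (complex_mean_value_le f g z (RtoC 0) _ (Cmod z)); auto.
  - split; [apply Cmod_ge_0|assumption].
  - lra.
  - rewrite Cmod_0. apply Cmod_ge_0.
  - intros t Ht.
    replace (RtoC 0 + RtoC t * (z - RtoC 0))%C with (RtoC t * z)%C by ring.
    replace (Cconj (z * g z) * (g (RtoC t * z) * (z - RtoC 0)))%C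
      with (Cconj z * ((Cconj (g z) * g (RtoC t * z)) * z))%C
      by (rewrite Cmult_conj; ring).
    rewrite Re_Cconj_mul_self. specialize (H t Ht).
    unfold Rdiv. apply Rmult_le_compat_l; [apply pow2_ge_0|]. lra.
Qed.

(* Since Re (conj (z f') f) >= |z|^2 / 4, the preimage of (1 - eps) f(z) near z,
   z - eps f / f' + O(eps^2 |z|^2), is closer to 0 than z. *)
Lemma radial_step (f g : C -> C) (q : R) :
  smooth_with f g -> f (RtoC 0) = RtoC 0 -> g (RtoC 0) = RtoC 1 ->
  (forall z, Cmod z < 1 -> 1 / 2 <= Re (g z)) ->
  (forall z t, Cmod z < 1 -> 0 <= t <= 1 ->
     1 / 4 <= Re (Cconj (g z) * g (RtoC t * z)%C)) ->
  0 <= q < 1 ->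
  exists e0, 0 < e0 < 1 /\ forall e z, 0 <= e <= e0 -> Cmod z <= q ->
    exists y, Cmod y <= Cmod z /\ f y = (RtoC (1 - e) * f z)%C.
Proof.
  intros Hs Hf0 Hg0 Hg Hray Hq.
  destruct (smooth_with_image_ball f g q Hs Hf0 Hg0 Hg Hq) as [M [HM [HB HI]]].
  assert (HM2 : 1 <= M ^ 2) by nra.
  assert (HM4 : M ^ 2 <= M ^ 4) by (replace (M ^ 4) with (M ^ 2 * M ^ 2) by ring; nra).
  (* The first bound absorbs the second-order errors: three terms of size at most M^2 d^2 = 64 M^4
     e^2 |z|^2 must not exceed the gain e |z|^2 / 2, and 384 = 2 * 3 * 64. The second gives 8 M e <=
     (1 - q) / 2. *)
  set (e0 := Rmin (/ (384 * M ^ 4)) ((1 - q) / (16 * M))).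
  assert (He0 : 0 < e0).
  { apply Rmin_pos; [apply Rinv_0_lt_compat; lra|apply Rdiv_lt_0_compat; lra]. }
  assert (He1 : forall e, e <= e0 -> e * (384 * M ^ 4) <= 1).
  { intros e He. apply Rle_trans with (/ (384 * M ^ 4) * (384 * M ^ 4)).
    - apply Rmult_le_compat_r; [lra|]. apply Rle_trans with (1 := He), Rmin_l.
    - rewrite Rinv_l; lra. }
  assert (He2 : forall e, e <= e0 -> e * (16 * M) <= 1 - q).
  { intros e He. apply Rle_div_r; [lra|]. apply Rle_trans with (1 := He), Rmin_r. }
  exists e0. split.
  - split; [assumption|]. specialize (He1 e0 (Rle_refl _)). nra.
  - intros e z [Hep He] Hz. specialize (He1 e He). specialize (He2 e He).
    destruct (HB z Hz) as [HGM HfM].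
    assert (Hz0 : 0 <= Cmod z) by apply Cmod_ge_0.
    (* The target lies at distance e |f z| <= 2 M e |z| = d / 4 from f z. *)
    set (d := 8 * M * e * Cmod z).
    assert (Hd : 0 <= 8 * M * e) by (repeat apply Rmult_le_pos; lra).
    assert (Hdz : 0 <= d <= 8 * M * e).
    { unfold d. split; [now apply Rmult_le_pos|].
      rewrite <- (Rmult_1_r (8 * M * e)) at 2. apply Rmult_le_compat_l; lra. }
    destruct (HI z d (RtoC (1 - e) * f z)%C Hz) as [y [Hy [Ey Hlin]]].
    + lra.
    + assert (M * d <= M * (8 * M * e)) by (apply Rmult_le_compat_l; lra).
      assert (e * M ^ 2 <= e * M ^ 4) by (apply Rmult_le_compat_l; lra). nra.
    + replace (RtoC (1 - e) * f z - f z)%C with (- (RtoC e * f z))%C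
        by (rewrite RtoC_minus; ring).
      rewrite Cmod_opp, Cmod_mult, Cmod_R, Rabs_pos_eq by lra.
      apply Rmult_le_compat_l with (r := e) in HfM; [|lra]. unfold d. lra.
    + exists y. split; [|assumption].
      assert (Hrz := ray_product_bound f g z Hs Hf0 ltac:(lra) (fun t => Hray z t ltac:(lra))).
      set (G := g z) in *. set (h := (y - z)%C) in *.
      set (r := (f y - f z - G * h)%C) in *.
      assert (HGh : (G * h = - (RtoC e * f z) - r)%C).
      { unfold r. rewrite Ey, RtoC_minus. ring. }
      assert (HG2 : 1 / 4 <= Cmod G ^ 2).
      { assert (H1 := Hg z ltac:(lra)). assert (H2 := re_le_Cmod (g z)).
        apply Rabs_le_between in H2. fold G in H1, H2. nra. }
      assert (Hid : Cmod G ^ 2 * Re (Cconj z * h)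
                    = - (e * Re (Cconj (z * G) * f z)) - Re (Cconj (z * G) * r)).
      { transitivity (Re (Cconj (z * G) * (G * h))).
        - apply Cmod2_mul_Re.
        - rewrite HGh. simpl. ring. }
      assert (Hr : - (Cmod z * M * (M * (d * d))) <= Re (Cconj (z * G) * r)).
      { assert (A1 := re_le_Cmod (Cconj (z * G) * r)).
        rewrite Cmod_mult, Cmod_conj, Cmod_mult in A1.
        apply Rabs_le_between in A1.
        assert (Cmod z * Cmod G * Cmod r <= Cmod z * M * (M * (d * d))).
        { apply Rmult_le_compat; auto using Cmod_ge_0.
          - apply Rmult_le_pos; apply Cmod_ge_0.
          - now apply Rmult_le_compat_l. }
        lra. }
      assert (Hy2 : Cmod y ^ 2 = Cmod z ^ 2 + 2 * Re (Cconj z * h) + Cmod h ^ 2).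
      { replace y with (z + h)%C by (unfold h; ring). apply Cmod2_plus. }
      assert (Hh2 : Cmod G ^ 2 * Cmod h ^ 2 <= M ^ 2 * d ^ 2).
      { apply Rmult_le_compat; try apply pow2_ge_0; apply pow_incr;
          split; auto using Cmod_ge_0. }
      (* The change of |z|^2 is estimated after multiplication by |G|^2, which is at least 1/4. *)
      assert (Hneg : Cmod G ^ 2 * (2 * Re (Cconj z * h) + Cmod h ^ 2) <= 0).
      { apply Rle_trans with
          (- (e * (Cmod z ^ 2 / 2)) + 2 * (Cmod z * M * (M * (d * d))) + M ^ 2 * d ^ 2).
        - apply Rmult_le_compat_l with (r := e) in Hrz; [|lra]. lra.
        - assert (Cmod z * M * (M * (d * d)) <= M ^ 2 * d ^ 2).
          { replace (Cmod z * M * (M * (d * d))) with (Cmod z * (M ^ 2 * d ^ 2)) by ring.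
            rewrite <- (Rmult_1_l (M ^ 2 * d ^ 2)) at 2.
            apply Rmult_le_compat_r; [|lra].
            apply Rmult_le_pos; apply pow2_ge_0. }
          replace (M ^ 2 * d ^ 2) with (64 * (e * (M ^ 4 * e)) * Cmod z ^ 2) in *
            by (unfold d; ring).
          assert (0 <= e * Cmod z ^ 2) by (apply Rmult_le_pos; [lra|apply pow2_ge_0]).
          assert (e * Cmod z ^ 2 * (e * (384 * M ^ 4)) <= e * Cmod z ^ 2 * 1)
            by (now apply Rmult_le_compat_l).
          lra. }
      assert (2 * Re (Cconj z * h) + Cmod h ^ 2 <= 0) by nra.
      apply Rsqr_incr_0_var; [|assumption]. unfold Rsqr. nra.
Qed.

(** A factor t > 0 is a finite product of factors in [1 - e0, 1]. Preimages never leave the disc of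
    radius |z|, so one e0 serves all steps; t = 0 is not reached in this way and is served by the
    origin. *)
Lemma radial_contraction (f g : C -> C) (t : R) (z : C) :
  smooth_with f g -> f (RtoC 0) = RtoC 0 -> g (RtoC 0) = RtoC 1 ->
  (forall z, Cmod z < 1 -> 1 / 2 <= Re (g z)) ->
  (forall z t, Cmod z < 1 -> 0 <= t <= 1 ->
     1 / 4 <= Re (Cconj (g z) * g (RtoC t * z)%C)) ->
  0 <= t <= 1 -> Cmod z < 1 ->
  exists y, Cmod y <= Cmod z /\ f y = (RtoC t * f z)%C.
Proof.
  intros Hs Hf0 Hg0 Hg Hray Ht Hz.
  destruct (Req_dec t 0) as [->|Ht0].
  { exists (RtoC 0). rewrite Cmod_0, Hf0. split; [apply Cmod_ge_0|ring]. }
  destruct (radial_step f g (Cmod z) Hs Hf0 Hg0 Hg Hray) as [e0 [He0 Hstep]].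
  { split; [apply Cmod_ge_0|assumption]. }
  assert (Hn : forall n t x, (1 - e0) ^ n <= t <= 1 -> Cmod x <= Cmod z ->
    exists y, Cmod y <= Cmod z /\ f y = (RtoC t * f x)%C).
  { induction n as [|n IH]; intros s x Hsn Hx.
    - exists x. split; [assumption|]. simpl in Hsn. replace s with 1 by lra. ring.
    - destruct (Rle_dec (1 - e0) s) as [Hse|Hse].
      + destruct (Hstep (1 - s) x ltac:(lra) Hx) as [y [Hy Ey]].
        exists y. split; [lra|]. rewrite Ey. do 2 f_equal. ring.
      + destruct (Hstep e0 x ltac:(lra) Hx) as [y [Hy Ey]].
        destruct (IH (s / (1 - e0)) y) as [y' [Hy' Ey']].
        * split; [apply Rle_div_r; simpl in Hsn; lra|apply Rle_div_l; lra].
        * lra.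
        * exists y'. split; [assumption|]. rewrite Ey', Ey, Cmult_assoc, <- RtoC_mult.
          do 2 f_equal. field. lra. }
  destruct (pow_lt_1_zero (1 - e0) ltac:(rewrite Rabs_pos_eq; lra) t ltac:(lra)) as [N HN].
  specialize (HN N (le_n N)). apply Rabs_def2 in HN.
  apply (Hn N); lra.
Qed.

Lemma starlike_of_quadrant_derivative (f g : C -> C) :
  smooth_with f g -> f (RtoC 0) = RtoC 0 -> g (RtoC 0) = RtoC 1 ->
  (forall z, Cmod z < 1 -> 1 / 2 <= Re (g z)) ->
  (forall z t, Cmod z < 1 -> 0 <= t <= 1 ->
     1 / 4 <= Re (Cconj (g z) * g (RtoC t * z)%C)) ->
  starlike f.
Proof.
  intros Hs Hf0 Hg0 Hg Hray.
  assert (Hstar : forall (w : C) (t : R), image f unit_disk w -> 0 <= t <= 1 ->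
                    image f unit_disk (RtoC t * w)%C).
  { intros w t [z [Hz Ez]] Ht. unfold unit_disk in Hz.
    destruct (radial_contraction f g t z Hs Hf0 Hg0 Hg Hray Ht Hz) as [y [Hy Ey]].
    exists y. split; [unfold unit_disk; lra|]. now rewrite Ey, Ez. }
  split; [split; [|split]|split; [|split; [split; [|split]|]]].
  - intros z Hz. exists (g z). now apply is_derive_smooth_with.
  - assumption.
  - rewrite <- Hg0. apply is_derive_smooth_with; [assumption|]. rewrite Cmod_0. lra.
  - now apply univalent_of_Re_pos with g.
  - exists (f (RtoC 0)). exists (RtoC 0). split; [|reflexivity].
    unfold unit_disk. rewrite Cmod_0. lra.
  - apply open_C_intro. intros w [z [Hz Ez]]. unfold unit_disk in Hz.
    assert (Hq : 0 <= Cmod z < 1) by (split; [apply Cmod_ge_0|assumption]).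
    destruct (smooth_with_image_ball f g (Cmod z) Hs Hf0 Hg0 Hg Hq) as [M [HM [_ HI]]].
    set (d := Rmin ((1 - Cmod z) / 2) (/ (4 * M))).
    assert (Hd : 0 < d).
    { apply Rmin_pos; [lra|apply Rinv_0_lt_compat; lra]. }
    assert (Hd1 : d <= (1 - Cmod z) / 2) by apply Rmin_l.
    assert (Hd2 : M * d <= 1 / 4).
    { apply Rle_trans with (M * / (4 * M)).
      - apply Rmult_le_compat_l; [lra|apply Rmin_r].
      - right. field. lra. }
    exists (d / 4). split; [lra|]. intros y Hy. rewrite <- Ez in Hy.
    destruct (HI z d y ltac:(lra) Hd1 Hd2 ltac:(lra)) as [u [Hu [Eu _]]].
    exists u. split; [|assumption]. unfold unit_disk.
    replace u with ((u - z) + z)%C by ring.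
    eapply Rle_lt_trans; [apply Cmod_triangle|]. lra.
  - now apply star_shaped_connected.
  - assumption.
Qed.

(** * Fejer's criterion *)

(** Serves to evaluate power series at the origin, where the partial sums are constant. *)
Lemma is_series_C_const (a : nat -> C) (c l : C) :
  @is_series C_AbsRing C_NormedModule a l -> (forall n, csum a n = c) -> l = c.
Proof.
  intros Hl Hc.
  assert (H : Cmod (c - l) <= 0).
  { apply le_epsilon. intros eps He.
    destruct (is_series_C_eps a l eps Hl He) as [N HN].
    specialize (HN N (le_n N)). rewrite Hc in HN. lra. }
  assert (E : Cmod (c - l) = 0) by (pose proof (Cmod_ge_0 (c - l)); lra).
  apply Cmod_eq_0 in E. replace l with (c - (c - l))%C by ring. rewrite E. ring.
Qed.

Lemma convex_decreasing_bound (b : nat -> R) (n : nat) :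
  convex_decreasing b -> 0 <= b n <= b 0%nat.
Proof.
  intros [Hp [Hd _]]. split; [apply Hp|].
  induction n as [|n IH]; [lra|]. specialize (Hd n). lra.
Qed.

Lemma ex_series_bounded_pow (b : nat -> R) (z : C) :
  (forall n, 0 <= b n <= 1) -> Cmod z < 1 ->
  @ex_series C_AbsRing C_NormedModule (fun n => RtoC (b n) * z ^ n)%C.
Proof.
  intros Hb Hz.
  apply (@ex_series_le C_AbsRing C_CompleteNormedModule _ (fun n => Cmod z ^ n)).
  - intros n. change (Cmod (RtoC (b n) * z ^ n) <= Cmod z ^ n).
    rewrite Cmod_mult, Cmod_R, Cmod_pow. specialize (Hb n).
    rewrite Rabs_pos_eq by lra.
    assert (0 <= Cmod z ^ n) by (apply pow_le, Cmod_ge_0). nra.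
  - apply ex_series_geom. rewrite Rabs_pos_eq; [assumption|apply Cmod_ge_0].
Qed.

(** M = 1 / (1 - q)^2 bounds both the sum of q^n, for g, and the sum of n q^(n-1), for the
    linearization error once the factor n + 1 has cancelled. *)
Lemma pow_series_smooth (b : nat -> R) (f g : C -> C) :
  (forall n, 0 <= b n <= 1) ->
  (forall z, Cmod z < 1 -> @is_series C_AbsRing C_NormedModule
     (fun n => RtoC (b n / INR (S n)) * z ^ S n)%C (f z)) ->
  (forall z, Cmod z < 1 -> @is_series C_AbsRing C_NormedModule
     (fun n => RtoC (b n) * z ^ n)%C (g z)) ->
  smooth_with f g.
Proof.
  intros Hb Hf Hg q Hq. exists (/ (1 - q) ^ 2).
  assert (Hq1 : 0 < (1 - q) ^ 2 <= 1 - q) by (split; [apply pow_lt; lra|nra]).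
  assert (HM : / (1 - q) <= / (1 - q) ^ 2) by (apply Rinv_le_contravar; lra).
  split; [|split].
  - rewrite <- Rinv_1. apply Rinv_le_contravar; lra.
  - intros z Hz.
    apply (Cmod_series_le _ (g z) (fun n => q ^ n) _ (Hg z ltac:(lra))).
    + intros n. rewrite Cmod_mult, Cmod_R, Cmod_pow. specialize (Hb n).
      rewrite Rabs_pos_eq by lra.
      assert (0 <= Cmod z ^ n) by (apply pow_le, Cmod_ge_0).
      assert (Cmod z ^ n <= q ^ n) by (apply pow_incr; split; [apply Cmod_ge_0|lra]).
      nra.
    + intros N. eapply Rle_trans; [apply sum_pow_le|]; lra.
  - intros p u v d Hp Hu Hv Hup Hvp.
    assert (H := is_series_minus _ _ _ _
      (is_series_minus _ _ _ _ (Hf u ltac:(lra)) (Hf v ltac:(lra)))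
      (is_series_scal (u - v)%C _ _ (Hg p ltac:(lra)))).
    match type of H with is_series ?a ?l => change l with (f u - f v - (u - v) * g p)%C in H end.
    rewrite (Cmult_comm (g p)).
    apply (Cmod_series_le _ _ (fun n => INR n * q ^ pred n * (d * Cmod (u - v))) _ H).
    + intros n. cbv beta.
      assert (HS : 0 < INR (S n)) by (apply lt_0_INR; lia).
      match goal with |- Cmod ?x <= _ =>
        change x with (RtoC (b n / INR (S n)) * u ^ S n - RtoC (b n / INR (S n)) * v ^ S n
          - (u - v) * (RtoC (b n) * p ^ n))%C end.
      replace (RtoC (b n / INR (S n)) * u ^ S n - RtoC (b n / INR (S n)) * v ^ S n
          - (u - v) * (RtoC (b n) * p ^ n))%C
        with (RtoC (b n / INR (S n))
          * (u ^ S n - v ^ S n - RtoC (INR (S n)) * p ^ n * (u - v)))%C.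
      * rewrite Cmod_mult, Cmod_R.
        assert (H1 := Cpow_linearization p u v q d n Hp Hu Hv Hup Hvp).
        specialize (Hb n).
        assert (H2 : 0 <= b n / INR (S n)) by (apply Rdiv_le_0_compat; lra).
        rewrite Rabs_pos_eq by assumption.
        eapply Rle_trans; [apply Rmult_le_compat_l; [assumption|exact H1]|].
        replace (b n / INR (S n) * (INR (S n) * (INR n * q ^ pred n) * (d * Cmod (u - v))))
          with (b n * (INR n * q ^ pred n * (d * Cmod (u - v)))) by (field; lra).
        rewrite <- (Rmult_1_l (INR n * q ^ pred n * (d * Cmod (u - v)))) at 2.
        apply Rmult_le_compat_r; [|lra].
        pose proof (Cmod_ge_0 (u - p)).
        repeat apply Rmult_le_pos; try lra; auto using Cmod_ge_0, pos_INR.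
        apply pow_le; lra.
      * replace (RtoC (b n)) with (RtoC (b n / INR (S n)) * RtoC (INR (S n)))%C.
        -- ring.
        -- rewrite <- RtoC_mult. f_equal. field. lra.
    + intros N. rewrite (sum_n_mult_r (K := R_Ring) (d * Cmod (u - v))
        (fun n => INR n * q ^ pred n)).
      change (sum_n (fun n => INR n * q ^ pred n) N * (d * Cmod (u - v))
              <= / (1 - q) ^ 2 * (d * Cmod (u - v))).
      pose proof (Cmod_ge_0 (u - p)).
      apply Rmult_le_compat_r; [apply Rmult_le_pos; [lra|apply Cmod_ge_0]|].
      now apply sum_n_pow_pred_le.
Qed.

Lemma fejer_starlike (b : nat -> R) (f : C -> C) :
  convex_decreasing b -> b 0%nat = 1 ->
  (forall z, Cmod z < 1 -> @is_series C_AbsRing C_NormedModule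
     (fun n => RtoC (b n / INR (S n)) * z ^ S n)%C (f z)) ->
  starlike f.
Proof.
  intros Hb Hb0 Hf.
  assert (Hb1 : forall n, 0 <= b n <= 1).
  { intros n. rewrite <- Hb0. now apply convex_decreasing_bound. }
  (* The formally differentiated series; that it is the derivative of f comes out of
     [smooth_with]. *)
  set (g := fun z => CSeries (fun n => RtoC (b n) * z ^ n)%C).
  assert (Hg : forall z, Cmod z < 1 -> @is_series C_AbsRing C_NormedModule
     (fun n => RtoC (b n) * z ^ n)%C (g z)).
  { intros z Hz. apply CSeries_correct. now apply ex_series_bounded_pow. }
  assert (H0 : Cmod (RtoC 0) < 1) by (rewrite Cmod_0; lra).
  apply starlike_of_quadrant_derivative with g.
  - now apply pow_series_smooth with b.
  - apply (is_series_C_const _ _ _ (Hf _ H0)).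
    induction n as [|n IH].
    + rewrite csum_O. simpl. ring.
    + rewrite csum_S, IH. simpl. ring.
  - apply (is_series_C_const _ _ _ (Hg _ H0)).
    induction n as [|n IH].
    + rewrite csum_O, Hb0. simpl. ring.
    + rewrite csum_S, IH. simpl. ring.
  - intros z Hz. apply convex_pow_series_Re with b z; auto.
  - intros z t Hz Ht. apply convex_pow_series_ray with b z t; auto.
    apply Hg. rewrite Cmod_mult, Cmod_R, Rabs_pos_eq by lra.
    pose proof (Cmod_ge_0 z). nra.
Qed.

(** * Convexity of the coefficients *)

Lemma is_derive_of_MVT (f f' : R -> R) (a x y : R) :
  (forall t, a <= t -> is_derive f t (f' t)) -> a <= x -> x <= y ->
  exists c, x <= c <= y /\ f y - f x = f' c * (y - x).
Proof.
  intros Hf Hx Hxy.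
  destruct (MVT_gen f x y f') as [c [Hc E]].
  - intros t Ht. rewrite Rmin_left, Rmax_right in Ht by lra. apply Hf. lra.
  - intros t Ht. rewrite Rmin_left, Rmax_right in Ht by lra.
    apply derivable_continuous_pt. exists (f' t). apply is_derive_Reals, Hf. lra.
  - rewrite Rmin_left, Rmax_right in Hc by lra. now exists c.
Qed.

(* The bound on [r] puts [r ^ 2] below the smaller root of
   Y^2 - (3 + 5 mu) Y + mu (2 mu + 1), which is at most [mu]. *)
Lemma radius_bound (mu r : R) :
  0 < mu -> 0 < r ->
  r <= sqrt (((3 + 5 * mu) - sqrt (17 * mu ^ 2 + 26 * mu + 9)) / 2) ->
  r ^ 2 <= mu /\
  forall X, 1 <= X ->
    0 <= (r ^ 2) ^ 2 - (3 + 5 * mu) * r ^ 2 * X + mu * (2 * mu + 1) * X ^ 2.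
Proof.
  intros Hmu Hr Hrs.
  set (d := sqrt (17 * mu ^ 2 + 26 * mu + 9)) in *.
  assert (Hd : d ^ 2 = 17 * mu ^ 2 + 26 * mu + 9) by (apply pow2_sqrt; nra).
  assert (Hd0 : 0 <= d) by apply sqrt_pos.
  assert (Hr2 : r ^ 2 <= ((3 + 5 * mu) - d) / 2).
  { destruct (Rle_dec 0 (((3 + 5 * mu) - d) / 2)) as [H|H].
    - rewrite <- (pow2_sqrt _ H). apply pow_incr. lra.
    (* For a negative argument [sqrt] is 0, which contradicts 0 < r. *)
    - rewrite sqrt_neg_0 in Hrs by lra. lra. }
  assert (Hd1 : 3 + 3 * mu <= d).
  { apply Rsqr_incr_0_var; [|assumption]. unfold Rsqr. nra. }
  split; [lra|]. intros X HX. clear Hrs.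
  (* The form is homogeneous in r^2 and X, with roots R0 X and R1 X in r^2; since X >= 1, neither
     falls below r^2. *)
  set (R0 := ((3 + 5 * mu) - d) / 2) in *. set (R1 := ((3 + 5 * mu) + d) / 2).
  replace ((r ^ 2) ^ 2 - (3 + 5 * mu) * r ^ 2 * X + mu * (2 * mu + 1) * X ^ 2)
    with ((R0 * X - r ^ 2) * (R1 * X - r ^ 2)).
  - assert (0 < r ^ 2) by (apply pow_lt; lra).
    assert (R0 <= R1) by (unfold R0, R1; lra).
    assert (r ^ 2 <= R0 * X) by nra.
    assert (R0 * X <= R1 * X) by nra.
    apply Rmult_le_pos; lra.
  - replace (mu * (2 * mu + 1)) with (((3 + 5 * mu) ^ 2 - d ^ 2) / 4) by (rewrite Hd; field).
    unfold R0, R1. field.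
Qed.

(** Increments of h over consecutive unit intervals are values of h1 at points c <= c', which the
    sign of h2 orders. *)
Lemma convex_decreasing_of_derive (h h1 h2 : R -> R) :
  (forall x, 1 <= x -> is_derive h x (h1 x)) ->
  (forall x, 1 <= x -> is_derive h1 x (h2 x)) ->
  (forall x, 1 <= x -> 0 <= h x) ->
  (forall x, 1 <= x -> h1 x <= 0) ->
  (forall x, 1 <= x -> 0 <= h2 x) ->
  convex_decreasing (fun n => h (INR (S n))).
Proof.
  intros D1 D2 P N1 P2.
  assert (H1 : forall n, 1 <= INR (S n)).
  { intros n. rewrite S_INR. pose proof (pos_INR n). lra. }
  assert (Hm : forall n, exists c, INR (S n) <= c <= INR (S n) + 1
     /\ h (INR (S (S n))) - h (INR (S n)) = h1 c).
  { intros n. destruct (is_derive_of_MVT h h1 1 (INR (S n)) (INR (S (S n))) D1 (H1 n))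
      as [c [Hc E]]; rewrite (S_INR (S n)) in *; [lra|].
    exists c. split; [assumption|]. rewrite E. ring. }
  repeat split; intros n.
  - now apply P.
  - destruct (Hm n) as [c [Hc E]]. specialize (N1 c). specialize (H1 n). lra.
  - destruct (Hm n) as [c [Hc E]]. destruct (Hm (S n)) as [c' [Hc' E']].
    rewrite (S_INR (S n)) in Hc'.
    specialize (H1 n).
    destruct (is_derive_of_MVT h1 h2 1 c c' D2) as [x [Hx Ex]]; [lra|lra|].
    specialize (P2 x ltac:(lra)).
    assert (0 <= h2 x * (c' - c)) by (apply Rmult_le_pos; lra). lra.
Qed.

(** The power is written with [exp] and [ln], the form that [auto_derive] differentiates. *)
Definition profile (mu r x : R) : R := x ^ 2 * exp (- (mu + 1) * ln (x ^ 2 + r ^ 2)).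

(** On [1, oo), h' has the sign of r^2 - mu x^2 and h'' that of the quadratic form in r^2 and X =
    x^2, so the bound r^2 <= mu gives monotonicity and the form gives convexity. *)
Lemma profile_convex (mu r : R) :
  0 < mu -> r ^ 2 <= mu ->
  (forall X, 1 <= X ->
    0 <= (r ^ 2) ^ 2 - (3 + 5 * mu) * r ^ 2 * X + mu * (2 * mu + 1) * X ^ 2) ->
  convex_decreasing (fun n => profile mu r (INR (S n))).
Proof.
  intros Hmu Hr HX.
  assert (Hpos : forall x, 1 <= x -> 0 < x ^ 2 + r ^ 2) by (intros; nra).
  apply convex_decreasing_of_derive with
    (fun x => 2 * (r ^ 2 * x - mu * x ^ 3) / (x ^ 2 + r ^ 2)
              * exp (- (mu + 1) * ln (x ^ 2 + r ^ 2)))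
    (fun x => 2 * ((r ^ 2) ^ 2 - (3 + 5 * mu) * r ^ 2 * x ^ 2
                   + mu * (2 * mu + 1) * (x ^ 2) ^ 2) / (x ^ 2 + r ^ 2) ^ 2
              * exp (- (mu + 1) * ln (x ^ 2 + r ^ 2)));
    intros x Hx; specialize (Hpos x Hx).
  - unfold profile. auto_derive; simpl pow in *; [lra|field; lra].
  - auto_derive; simpl pow in *; [repeat split; lra|field; lra].
  - apply Rmult_le_pos; [apply pow2_ge_0|left; apply exp_pos].
  - assert (E := exp_pos (- (mu + 1) * ln (x ^ 2 + r ^ 2))).
    assert (I := Rinv_0_lt_compat _ Hpos).
    assert (r ^ 2 * x - mu * x ^ 3 <= 0).
    { replace (r ^ 2 * x - mu * x ^ 3) with (- (x * (mu * x ^ 2 - r ^ 2))) by ring.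
      assert (0 <= mu * (x ^ 2 - 1)) by (apply Rmult_le_pos; nra).
      assert (0 <= x * (mu * x ^ 2 - r ^ 2)) by (apply Rmult_le_pos; lra). lra. }
    apply Ropp_le_cancel. rewrite Ropp_0.
    replace (- _) with (2 * - (r ^ 2 * x - mu * x ^ 3) * / (x ^ 2 + r ^ 2)
              * exp (- (mu + 1) * ln (x ^ 2 + r ^ 2))) by (unfold Rdiv; ring).
    repeat apply Rmult_le_pos; lra.
  - repeat apply Rmult_le_pos; try lra.
    + apply HX. nra.
    + left. apply Rinv_0_lt_compat, pow_lt, Hpos.
    + left. apply exp_pos.
Qed.

Lemma convex_decreasing_scal (c : R) (b : nat -> R) :
  0 <= c -> convex_decreasing b -> convex_decreasing (fun n => c * b n).
Proof.
  intros Hc [Hp [Hd Hx]]. repeat split; intros n.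
  - now apply Rmult_le_pos.
  - now apply Rmult_le_compat_l.
  - rewrite <- !Rmult_minus_distr_l. now apply Rmult_le_compat_l.
Qed.

Theorem theorem2p2 (mu r : R) (hmu : 0 < mu) (hr : 0 < r)
  (hr' : r <= sqrt (((3 + 5 * mu) - sqrt (17 * mu ^ 2 + 26 * mu + 9)) / 2)) :
  starlike (F mu r).
Proof.
  destruct (radius_bound mu r hmu hr hr') as [Hr HX].
  set (c := Rpower (r ^ 2 + 1) (mu + 1)).
  assert (Hcoef : forall n, c * profile mu r (INR (S n)) / INR (S n) = Fcoef mu r (S n)).
  { intros n. assert (0 < INR (S n)) by (apply lt_0_INR; lia).
    unfold profile, Fcoef. fold c. unfold Rpower at 1.
    rewrite Ropp_mult_distr_l_reverse, exp_Ropp. field.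
    split; [apply Rgt_not_eq, exp_pos|lra]. }
  assert (H1 : Fcoef mu r 1 = 1).
  { unfold Fcoef. simpl INR. replace (1 ^ 2 + r ^ 2) with (r ^ 2 + 1) by ring.
    field. apply Rgt_not_eq, exp_pos. }
  apply fejer_starlike with (fun n => c * profile mu r (INR (S n))).
  - apply convex_decreasing_scal; [left; apply exp_pos|now apply profile_convex].
  - rewrite <- H1, <- (Hcoef 0%nat). simpl INR. field.
  - intros z Hz.
    apply (is_series_ext (fun n => RtoC (Fcoef mu r (S n)) * z ^ S n)%C).
    { intros n. now rewrite Hcoef. }
    (* [F] writes the term z apart and starts its series at exponent 2; the head, with coefficient 1
       by [H1], is split off accordingly. *)
    apply is_series_decr_1.
    match goal with |- is_series _ ?l =>
      replace l with (CSeries (fun k => RtoC (Fcoef mu r (k + 2)) * z ^ (k + 2)))%C end.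
    + apply (is_series_ext (fun k => RtoC (Fcoef mu r (k + 2)) * z ^ (k + 2))%C).
      { intros k. now rewrite Nat.add_comm. }
      apply CSeries_correct. now apply ex_series_F.
    + unfold F. rewrite H1.
      set (l := CSeries _).
      change (l = z + l + - (RtoC 1 * (z * 1)))%C. ring.
Qed.
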